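(* Let $k$ be a field of characteristic $p>0$. Suppose $H$ is a pointed rank one Hopf algebra over $k$ of nilpotent type such that $H\cong H_R$ for some tuple $R=(G,\chi,a,\alpha)$ or $H\cong H_F$ for some tuple $F=(G,\chi,c,a,(\alpha_{-1},\alpha_0))$; identify $H$ with $H_R$ respectively $H_F$, with generator $x$, and let $n$ be the degree of $x$ ($n=N$, the order of $\chi(a)$, for $H_R$, and $n=p$ for $H_F$). (a) The simple $H$-modules are the simple $kG$-modules on which $x$ acts as zero. (b) Assume that the coradical of $H$ is semi-simple. Let $L_\lambda$ be the simple $H$-module whose restriction to $kG$ has character $\lambda$, and let $e_\lambda$ be a primitive idempotent of $kG$ associated to $\lambda$. Then $He_\lambda$ is an indecomposable projective $H$-module, and every indecomposable projective $H$-module is isomorphic to some $He_\lambda$. (c) Assume that the coradical of $H$ is semi-simple. The module $He_\lambda$ is uniserial, with composition factors $$L_\lambda,\ L_{\lambda\chi},\ L_{\lambda\chi^2},\ \ldots,\ L_{\lambda\chi^{n-1}}.$$ Hence two projectives $He_\lambda$, $He_\mu$ are in the same block if and only if $\mu=\lambda\chi^i$ for some $i$.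
   Context: For a pointed finite-dimensional Hopf algebra $H$: $H_0=kG(H)$ is its coradical, $H_1=\Delta^{-1}(H\otimes H_0+H_0\otimes H)$, and $H$ has rank one if $\dim_k k\otimes_{H_0}H_1=2$ ($k$ trivial via the counit). The degree of $y\in H_1\setminus H_0$ is the smallest $n$ with $y^n\in\sum_{i<n}H_0y^i$. First type $H_R$. Let $R=(G,\chi,a,\alpha)$ where $G$ is a finite group, $a\in Z(G)$, $\chi:G\to k^*$ a linear character with $\chi(a)\ne 1$, $\alpha=(\alpha_{-1},\alpha_0,\dots,\alpha_{r-1})\in k^{r+1}$, $r\ge 0$. Let $N$ be the order of $\chi(a)$ and $n=p^rN$. It is assumed that $\alpha_{-1}=0$ if $a^n=1$; that if $\alpha_i\ne0$ for some $i\ge0$ then $a^{N(p^r-p^i)}=1$ and $\chi(g)^{N(p^r-p^i)}=1$ for all $g\in G$; and that if $\alpha_{-1}\neq0$ then $\chi(g)^{Np^r}=1$ for all $g\in G$. $H_R$ is the algebra containing $kG$ and an element $x$, with basis $(gx^i)_{g\in G,\,0\le i\le n-1}$ and relations $gxg^{-1}=\chi(g)x$ ($g\in G$), $x^n=\alpha_{-1}(a^n-1)+\sum_{i=0}^{r-1}\alpha_ix^{p^iN}$; its Hopf structure is $\Delta(gx^i)=(g\otimes g)(x\otimes a+1\otimes x)^i$, $\epsilon(gx^i)=\delta_{i,0}$, $S(gx^i)=(-xa^{-1})^ig^{-1}$. It is of rank one exactly when $r=0$. Second type $H_F$. Let $F=(G,\chi,c,a,(\alpha_{-1},\alpha_0))$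 where $G$ is a finite group, $a\in Z(G)$, $\chi:G\to k^*$ a linear character with $\chi(a)=1$, $c:G\to k$ a map with $c(hg)=\chi(g)c(h)+c(g)$ for all $g,h\in G$ and $c(a)=0$, and $\alpha_{-1},\alpha_0\in k$ with $\alpha_0\in\{0,1\}$ and $\alpha_{-1}=0$ if $\alpha_0=0$. It is assumed that if $\alpha_0=0$ then $c(g)(a^p-1)=0$ in $kG$ for all $g\in G$; and if $\alpha_0=1$ then $a^p=a$, and for all $g\in G$ one has $\chi(g)\in\mathbb{F}_p^*$ and $(\alpha_{-1}(\chi(g)-1)+c(g)^p-c(g))(a-1)=0$ in $kG$. $H_F$ is the algebra containing $kG$ and an element $x$, with basis $\{gx^i: g\in G,0\le i\le p-1\}$ and relations $x^p=\alpha_{-1}(a^p-1)+\alpha_0x$, $gxg^{-1}=\chi(g)x+c(g)(a-1)$ ($g\in G$); its Hopf structure is given by the same formulas as for $H_R$ on this basis. Nilpotent type: with $P_{a,1}=\{y:\Delta(y)=y\otimes a+1\otimes y\}$, $H$ is of nilpotent type if there is an eigenvector $y\in P_{a,1}\setminus H_0$ of the conjugation action of $a$ with $y^n=0$, $n$ the degree of $y$. For rank one $H_R$ this means $\alpha_{-1}=0$ (so $x^N=0$), and for $H_F$ it means $\alpha_0=\alpha_{-1}=0$ (so $x^p=0$). In both cases the coradical is $kG$. *)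

(* Defs.v *)
From HB Require Import structures.
From mathcomp Require Import all_boot all_order all_fingroup all_algebra all_solvable all_field.

Set Implicit Arguments.
Unset Strict Implicit.
Unset Printing Implicit Defensive.

Import GRing.Theory.
Local Open Scope ring_scope.

(** * Modules over a ring: submodules are Prop-valued predicates *)

Section Modules.
Variable A : nzRingType.
Implicit Types M N L : lmodType A.

Definition submodule M (U : M -> Prop) :=
  U 0 /\ forall (a : A) (u v : M), U u -> U v -> U (a *: u + v).

Definition simple_mod M :=
  (exists m : M, m <> 0) /\
  forall U : M -> Prop, submodule U ->
    (forall m, U m -> m = 0) \/ (forall m, U m).

Definition iso_mod M N := exists f : {linear M -> N}, bijective f.

Definition projective_mod (P : lmodType A) :=
  forall (M N : lmodType A) (f : {linear M -> N}) (g : {linear P -> N}),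
    (forall y, exists x, f x = y) ->
    exists h : {linear P -> M}, forall u, f (h u) = g u.

Definition indecomposable_mod M :=
  (exists m : M, m <> 0) /\
  forall U W : M -> Prop, submodule U -> submodule W ->
    (forall m, exists u w, [/\ U u, W w & m = u + w]) ->
    (forall m, U m -> W m -> m = 0) ->
    (forall m, U m -> m = 0) \/ (forall m, W m -> m = 0).

Definition uniserial_mod M :=
  forall U W : M -> Prop, submodule U -> submodule W ->
    (forall m, U m -> W m) \/ (forall m, W m -> U m).

(* For submodules W <= U of M: U / W is isomorphic to L, i.e. there is an
   epimorphism from U onto L with kernel W.  The values of f outside U are
   irrelevant. *)
Definition quotient_iso M (U W : M -> Prop) L :=
  exists f : M -> L,
    [/\ forall a u v, U u -> U v -> f (a *: u + v) = a *: f u + f v,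
        forall l, exists2 u, U u & f u = l
      & forall u, U u -> (f u = 0 <-> W u)].

(* A chain M = F 0 >= F 1 >= ... >= F n = 0 of submodules such that, for
   i < n, the modules satisfying P i (which exist) are isomorphic to
   F i / F i.+1. *)
Definition descending_series M (n : nat) (P : nat -> lmodType A -> Prop) :=
  exists F : nat -> M -> Prop,
    [/\ forall i, submodule (F i),
        forall m, F 0%N m,
        forall m, F n m -> m = 0
      & forall i, (i < n)%N ->
        [/\ forall m, F i.+1 m -> F i m,
            exists L, P i L
          & forall L, P i L -> quotient_iso (F i) (F i.+1) L]].

Definition primitive_idem (e : A) :=
  [/\ e <> 0, e * e = e
    & forall f g : A, f * f = f -> g * g = g -> f * g = 0 -> g * f = 0 ->
        e = f + g -> f = 0 \/ g = 0].

Definition central_elt (z : A) := forall u : A, z * u = u * z.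

(* Block idempotents. *)
Definition central_primitive_idem (z : A) :=
  [/\ central_elt z, z <> 0, z * z = z
    & forall f g : A, central_elt f -> central_elt g ->
        f * f = f -> g * g = g -> f * g = 0 ->
        z = f + g -> f = 0 \/ g = 0].

Definition same_block M N :=
  exists2 z : A, central_primitive_idem z
    & (forall m : M, z *: m = m) /\ (forall m : N, z *: m = m).

End Modules.

(** * Restriction of scalars *)

Definition restr (A B : nzRingType) (f : {rmorphism A -> B}) (M : lmodType B)
  : Type := M.

Section Restriction.
Variables (A B : nzRingType) (f : {rmorphism A -> B}) (M : lmodType B).

HB.instance Definition _ := GRing.Zmodule.on (restr f M).

Definition restr_scale (a : A) (m : restr f M) : restr f M :=
  (f a *: (m : M) : M).

Fact restr_scaleA a b v :
  restr_scale a (restr_scale b v) = restr_scale (a * b) v.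
Proof. by rewrite /restr_scale scalerA rmorphM. Qed.

Fact restr_scale1 : left_id 1 restr_scale.
Proof. by move=> v; rewrite /restr_scale rmorph1 scale1r. Qed.

Fact restr_scaleDr : right_distributive restr_scale +%R.
Proof. by move=> a u v; rewrite /restr_scale; exact: scalerDr. Qed.

Fact restr_scaleDl v : {morph restr_scale^~ v : a b / a + b}.
Proof. by move=> a b; rewrite /restr_scale rmorphD; exact: scalerDl. Qed.

HB.instance Definition _ := GRing.Zmodule_isLmodule.Build A (restr f M)
  restr_scaleA restr_scale1 restr_scaleDr restr_scaleDl.
End Restriction.

(** * The left ideal A e, as a left A-module *)

Section LeftIdeal.
Variables (k : fieldType) (A : falgType k) (e : A).

Definition lideal_pred : {pred A^o} := fun v => (v : A) \in limg (amulr e).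

Fact lideal_submod_closed : submod_closed lideal_pred.
Proof.
split=> [|a u v]; first exact: mem0v.
move=> /memv_imgP[u' _ ->] /memv_imgP[v' _ ->]; apply/memv_imgP.
exists (a * u' + v'); first exact: memvf.
by rewrite !lfunE /= mulrDl -mulrA.
Qed.

HB.instance Definition _ :=
  GRing.isSubmodClosed.Build A A^o lideal_pred lideal_submod_closed.

Definition lideal : Type := {v : A^o | v \in lideal_pred}.

HB.instance Definition _ := SubChoice.on lideal.
HB.instance Definition _ := [SubChoice_isSubZmodule of lideal by <:].
HB.instance Definition _ := [SubZmodule_isSubLmodule of lideal by <:].
End LeftIdeal.

(** * The group algebra kG *)

Definition grpalg (k : fieldType) (G : finGroupType) : Type :=
  {ffun G -> k^o}.

Section GroupAlgebra.
Variables (k : fieldType) (G : finGroupType).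
Notation kG := (grpalg k G).

HB.instance Definition _ := Vector.on kG.

Definition gelt (g : G) : kG := [ffun h => (h == g)%:R].

Definition grpalg_mul (u v : kG) : kG :=
  [ffun g => \sum_h u h * v (h^-1 * g)%g].

Fact grpalg_mulA : associative grpalg_mul.
Proof.
move=> u v w; apply/ffunP=> g; rewrite !ffunE.
under eq_bigr => h _ do rewrite ffunE mulr_sumr.
under [RHS]eq_bigr => h _ do rewrite ffunE mulr_suml.
rewrite [RHS]exchange_big; apply: eq_bigr => h _ /=.
rewrite (reindex_inj (mulgI h^-1%g)); apply: eq_bigr => l _ /=.
by rewrite mulrA invMg invgK -mulgA mulKVg.
Qed.

Fact grpalg_mul1l : left_id (gelt 1) grpalg_mul.
Proof.
move=> u; apply/ffunP=> g; rewrite ffunE (bigD1 1%g) //= ffunE eqxx mul1r.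
rewrite invg1 mul1g big1 ?addr0 // => h /negPf h1.
by rewrite ffunE h1 mul0r.
Qed.

Fact grpalg_mul1r : right_id (gelt 1) grpalg_mul.
Proof.
move=> u; apply/ffunP=> g; rewrite ffunE (bigD1 g) //= ffunE mulVg eqxx mulr1.
rewrite big1 ?addr0 // => h hg.
by rewrite ffunE -eq_mulVg1 (negPf hg) mulr0.
Qed.

Fact grpalg_mulDl : left_distributive grpalg_mul +%R.
Proof.
move=> u v w; apply/ffunP=> g; rewrite !ffunE -big_split; apply: eq_bigr => h _.
by rewrite ffunE mulrDl.
Qed.

Fact grpalg_mulDr : right_distributive grpalg_mul +%R.
Proof.
move=> u v w; apply/ffunP=> g; rewrite !ffunE -big_split; apply: eq_bigr => h _.
by rewrite ffunE mulrDr.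
Qed.

Fact grpalg_1neq0 : gelt 1 != 0 :> kG.
Proof.
by apply/eqP=> /ffunP/(_ 1%g)/eqP; rewrite !ffunE eqxx oner_eq0.
Qed.

HB.instance Definition _ := GRing.Zmodule_isNzRing.Build kG
  grpalg_mulA grpalg_mul1l grpalg_mul1r grpalg_mulDl grpalg_mulDr grpalg_1neq0.

Fact grpalg_scaleAl (c : k) (u v : kG) : c *: (u * v) = c *: u * v.
Proof.
apply/ffunP=> g; rewrite !ffunE scaler_sumr; apply: eq_bigr => h _.
by rewrite !ffunE; exact: mulrA.
Qed.

HB.instance Definition _ := GRing.Lmodule_isLalgebra.Build k kG grpalg_scaleAl.

Fact grpalg_scaleAr (c : k) (u v : kG) : c *: (u * v) = u * (c *: v).
Proof.
apply/ffunP=> g; rewrite !ffunE scaler_sumr; apply: eq_bigr => h _.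
by rewrite !ffunE; exact: mulrCA.
Qed.

HB.instance Definition _ := GRing.Lalgebra_isAlgebra.Build k kG grpalg_scaleAr.
HB.instance Definition _ := Algebra_isFalgebra.Build k kG.

(* V is finite-dimensional over k with character lam: b is a k-basis of V,
   r g is the matrix of g in that basis, and lam g is its trace. *)
Definition has_character (V : lmodType kG) (lam : G -> k) :=
  exists (d : nat) (b : 'I_d -> V) (r : G -> 'M[k]_d),
    [/\ bijective (fun c : 'rV[k]_d => \sum_i (c 0 i)%:A *: b i),
        forall g j, gelt g *: b j = \sum_i (r g i j)%:A *: b i
      & forall g, lam g = \tr (r g)].

End GroupAlgebra.

(** * Tensor products of finite-dimensional spaces *)

(* U (x) V in coordinates on the bases vbasis {:U} and vbasis {:V}: the tensor
   sum_(i, j) t_ij (b_i (x) b'_j) is the matrix (t_ij). *)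
Definition tensor (k : fieldType) (U V : vectType k) : vectType k :=
  'M[k]_(\dim {:U}, \dim {:V}).

Section Tensor.
Variables (k : fieldType) (U V : vectType k).

Definition tens (u : U) (v : V) : tensor U V :=
  \matrix_(i, j) (coord (vbasis {:U}) i u * coord (vbasis {:V}) j v).

(* The linear map u (x) v |-> f u v, for f bilinear. *)
Definition tlift (W : vectType k) (f : U -> V -> W) (t : tensor U V) : W :=
  \sum_i \sum_j t i j *: f (vbasis {:U})`_i (vbasis {:V})`_j.

Definition tens_vs (X : {vspace U}) (Y : {vspace V}) : {vspace tensor U V} :=
  <<[seq tens u v | u <- vbasis X, v <- vbasis Y]>>%VS.

End Tensor.

Definition tmap (k : fieldType) (U V U' V' : vectType k)
    (f : U -> U') (g : V -> V') : tensor U V -> tensor U' V' :=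
  tlift (fun u v => tens (f u) (g v)).

Definition tassoc (k : fieldType) (U V W : vectType k) :
    tensor (tensor U V) W -> tensor U (tensor V W) :=
  tlift (fun t w => tlift (fun u v => tens u (tens v w)) t).

Definition tmul (k : fieldType) (A B : falgType k) (s t : tensor A B) :
    tensor A B :=
  tlift (fun u v => tlift (fun u' v' => tens (u * u') (v * v')) t) s.

Definition tpow (k : fieldType) (A B : falgType k) (t : tensor A B) (i : nat) :=
  iter i (tmul t) (tens 1 1).

(** * Finite-dimensional Hopf algebras *)

Record hopfAlg (k : fieldType) := HopfAlg {
  hopf_sort :> falgType k;
  comul : 'Hom(hopf_sort, tensor hopf_sort hopf_sort);
  counit : {lrmorphism hopf_sort -> k^o};
  antipode : 'End(hopf_sort);
  comulA : forall u,
    tassoc (tmap comul id (comul u)) = tmap id comul (comul u);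
  comul_counitl : forall u, tlift (fun v w => counit v *: w) (comul u) = u;
  comul_counitr : forall u, tlift (fun v w => counit w *: v) (comul u) = u;
  comul1 : comul 1 = tens 1 1;
  comulM : forall u v, comul (u * v) = tmul (comul u) (comul v);
  antipodel : forall u,
    tlift (fun v w => antipode v * w) (comul u) = (counit u)%:A;
  antipoder : forall u,
    tlift (fun v w => v * antipode w) (comul u) = (counit u)%:A
}.

Section HopfNotions.
Variables (k : fieldType) (H : hopfAlg k).
Implicit Types (C D U : {vspace H}).

Definition grouplike (a : H) := comul H a = tens a a /\ counit H a = 1.

Definition subcoalgebra C := (comul H @: C <= tens_vs C C)%VS.

Definition simple_subcoalgebra C :=
  [/\ C <> 0%VS, subcoalgebra C
    & forall D, subcoalgebra D -> (D <= C)%VS -> D = 0%VS \/ D = C].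

(* H0 is the sum of all simple subcoalgebras of H. *)
Definition is_coradical (H0 : {vspace H}) :=
  (forall C, simple_subcoalgebra C -> (C <= H0)%VS) /\
  (forall U, (forall C, simple_subcoalgebra C -> (C <= U)%VS) -> (H0 <= U)%VS).

Definition pointed := forall C, simple_subcoalgebra C -> \dim C = 1%N.

(* In the remaining definitions H0 stands for the coradical of H. *)

Definition corad1 (H0 : {vspace H}) : {vspace H} :=
  (comul H @^-1: (tens_vs fullv H0 + tens_vs H0 fullv))%VS.

(* k (x)_{H0} H1 is the quotient of k (x)_k H1 = H1 by the relations
   1.h (x) m = 1 (x) h m, with 1.h = counit h, for h in H0 and m in H1. *)
Definition trivial_tensor_rel (H0 : {vspace H}) : {vspace H} :=
  <<[seq (counit H h *: m - h * m : H) | h <- vbasis H0, m <- vbasis (corad1 H0)]>>%VS.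

Definition rank_one (H0 : {vspace H}) :=
  \dim (corad1 H0) = (2 + \dim (trivial_tensor_rel H0))%N.

Definition is_degree (H0 : {vspace H}) (y : H) (n : nat) :=
  y ^+ n \in (\sum_(i < n) H0 * <[y ^+ i]>)%VS /\
  forall m, (m < n)%N -> y ^+ m \notin (\sum_(i < m) H0 * <[y ^+ i]>)%VS.

Definition skew_primitive (a y : H) := comul H y = tens y a + tens 1 y.

Definition nilpotent_type (H0 : {vspace H}) :=
  exists (a y : H) (s : k) (n : nat),
    [/\ grouplike a, skew_primitive a y, y \notin H0 & a * y * a^-1 = s *: y] /\
    is_degree H0 y n /\ y ^+ n = 0.

(* Semisimplicity of a subalgebra H0 of H: every left ideal of H0 has a
   complementary left ideal. *)
Definition semisimple_subalg (H0 : {vspace H}) :=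
  forall U, (U <= H0)%VS -> (H0 * U <= U)%VS ->
    exists W, [/\ (W <= H0)%VS, (H0 * W <= W)%VS,
                  (U + W)%VS = H0 & (U :&: W)%VS = 0%VS].

End HopfNotions.

(** * The Hopf algebras H_R and H_F *)

Definition linear_character (k : fieldType) (G : finGroupType) (chi : G -> k) :=
  chi 1%g = 1 /\ forall g h, chi (g * h)%g = chi g * chi h.

Record datumR (k : fieldType) (p : nat) (G : finGroupType) := DatumR {
  R_chi : G -> k;
  R_a : G;
  R_r : nat;
  R_am1 : k;
  R_al : 'I_R_r -> k;
  R_N : nat;
  R_chi_lin : linear_character R_chi;
  R_a_central : R_a \in 'Z([set: G])%g;
  R_chi_a : R_chi R_a != 1;
  R_N_order : R_N.-primitive_root (R_chi R_a);
  R_n := (p ^ R_r * R_N)%N;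
  R_am1_triv : (R_a ^+ R_n = 1)%g -> R_am1 = 0;
  R_al_cond : forall i : 'I_R_r, R_al i != 0 ->
    (R_a ^+ (R_N * (p ^ R_r - p ^ i)) = 1)%g /\
    forall g, R_chi g ^+ (R_N * (p ^ R_r - p ^ i)) = 1;
  R_am1_cond : R_am1 != 0 -> forall g, R_chi g ^+ (R_N * p ^ R_r) = 1
}.

Record datumF (k : fieldType) (p : nat) (G : finGroupType) := DatumF {
  F_chi : G -> k;
  F_c : G -> k;
  F_a : G;
  F_am1 : k;
  F_a0 : k;
  F_chi_lin : linear_character F_chi;
  F_a_central : F_a \in 'Z([set: G])%g;
  F_chi_a : F_chi F_a = 1;
  F_cM : forall g h, F_c (h * g)%g = F_chi g * F_c h + F_c g;
  F_c_a : F_c F_a = 0;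
  F_a0_01 : F_a0 = 0 \/ F_a0 = 1;
  F_am1_triv : F_a0 = 0 -> F_am1 = 0;
  F_cond0 : F_a0 = 0 ->
    forall g, F_c g *: (gelt k (F_a ^+ p)%g - 1) = 0;
  F_cond1 : F_a0 = 1 ->
    (F_a ^+ p)%g = F_a /\
    forall g, (exists2 m : nat, (0 < m < p)%N & F_chi g = m%:R) /\
      (F_am1 * (F_chi g - 1) + F_c g ^+ p - F_c g) *: (gelt k F_a - 1) = 0
}.

Section Presentations.
Variables (k : fieldType) (p : nat) (G : finGroupType) (H : hopfAlg k).
Variables (j : {lrmorphism grpalg k G -> H}) (x : H).
Notation jg g := (j (gelt k g)).

Definition gx_basis (n : nat) :=
  basis_of {:H} [seq jg g * x ^+ i | g <- enum G, i <- iota 0 n].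

Definition gx_hopf (a : G) (n : nat) :=
  forall (g : G) (i : nat), (i < n)%N ->
    [/\ comul H (jg g * x ^+ i) =
          tmul (tens (jg g) (jg g)) (tpow (tens x (jg a) + tens 1 x) i),
        counit H (jg g * x ^+ i) = (i == 0%N)%:R
      & antipode H (jg g * x ^+ i) = (- x * jg a^-1%g) ^+ i * jg g^-1%g].

(* H is H_R, with inclusion j : kG -> H and generator x. *)
Definition is_HR (R : datumR k p G) :=
  [/\ gx_basis (R_n R),
      forall g, jg g * x * jg g^-1%g = R_chi R g *: x,
      x ^+ R_n R = R_am1 R *: (jg (R_a R ^+ R_n R)%g - 1)
                   + \sum_(i < R_r R) R_al i *: x ^+ (p ^ i * R_N R)
    & gx_hopf (R_a R) (R_n R)].

(* H is H_F, with inclusion j : kG -> H and generator x. *)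
Definition is_HF (F : datumF k p G) :=
  [/\ gx_basis p,
      forall g, jg g * x * jg g^-1%g
                = F_chi F g *: x + F_c F g *: (jg (F_a F) - 1),
      x ^+ p = F_am1 F *: (jg (F_a F ^+ p)%g - 1) + F_a0 F *: x
    & gx_hopf (F_a F) p].

(* L is the simple H-module whose restriction to kG has character lam. *)
Definition simple_with_char (lam : G -> k) (L : lmodType H) :=
  simple_mod L /\ has_character (restr j L) lam.

End Presentations.

(* e is a primitive idempotent of kG associated to lam. *)
Definition idem_assoc (k : fieldType) (G : finGroupType) (lam : G -> k)
    (e : grpalg k G) :=
  primitive_idem e /\ has_character (lideal e) lam.

Definition twist (k : fieldType) (G : finGroupType) (lam chi : G -> k) (i : nat)
  : G -> k := fun g => lam g * chi g ^+ i.

(* Main.v *)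
From HB Require Import structures.
Require Import Defs.
From mathcomp Require Import all_boot all_order all_fingroup all_algebra all_solvable all_field.
From mathcomp Require freeg.
From Stdlib Require Import Classical.

Set Implicit Arguments.
Unset Strict Implicit.
Unset Printing Implicit Defensive.

Import GRing.Theory.
Local Open Scope ring_scope.

(** Both families of Hopf algebras have the same shape: H is free over kG on
    the powers 1, x, ..., x^(n-1), with g x g^-1 = chi(g) x + c(g) (a - 1),
    where c = 0 for H_R.  The argument has three stages.

    Nilpotency.  The coefficients of Delta (g x^i) are Gaussian binomials.
    Comparing leading coefficients in Delta u = s (u (x) u) shows that every
    one-dimensional subcoalgebra lies in kG, so the coradical is kG
    ([coradicalE]).  If a skew primitive y has a nonzero coefficient at x^m,
    m > 0, then the middle binomials of m vanish, hence x^m is itself skew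
    primitive; rank one leaves room only for m = 1 ([rank_one_skew]).
    Therefore y = c x + t (a - 1) ([skew_primitiveE]), and the nilpotency of
    y forces x^n = 0 ([HR_nil], [HF_nil]).

    Simple modules.  Wherever c(g) is nonzero one has a^p = 1, so that a - 1
    is central and nilpotent and kills every simple module.  The kernel of x
    is then a nonzero submodule of any simple module, which makes x act as
    zero ([simple_restr]); conversely h |-> (constant coefficient of h) turns
    a simple kG-module into an H-module ([inflation]).

    Semisimple coradical.  Now |G| is invertible in k, c(g) (a - 1) = 0, and
    x u = shift(u) x for the automorphism shift(g) = chi(g)^-1 g of kG.  For a
    primitive idempotent e each x^i He / x^(i+1) He is a twist of the simple
    module kGe, so the x^i He are the only submodules of He
    ([submodule_xlayer]).  This gives uniseriality, indecomposability and the
    composition factors.  An indecomposable projective maps to some He with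
    image outside xHe, hence onto He, and this map splits
    ([projective_classification]).  For blocks, x e = shift(e) x shows that a
    block idempotent fixing e fixes shift(e); conversely the ideal of kG
    annihilating all shift^i(e) is generated by a central idempotent of kG
    that is invariant under shift, hence central in H, and it separates e from
    every idempotent outside the orbit of its twists.

    Over a field of characteristic p that need not be algebraically closed, a
    simple module must still be recognised by its character.  The device is
    the form trace_form u e = sum_g (g^-1 u g e)(1): it computes the character
    of kGe, it is symmetric in products of its second argument, and
    trace_form u 1 = |G| u(1), so it cannot vanish on the two-sided ideal of e
    ([idem_assoc_act]). *)

(** * Subspaces given by predicates *)

(** A closed subset of maximal dimension exists because dimensions are
    bounded; this lets projections be used for submodules given by
    predicates. *)
Lemma submodule_vspace (k : fieldType) (V : vectType k) (U : V -> Prop) :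
  U 0 -> (forall a u v, U u -> U v -> U (a *: u + v)) ->
  exists W : {vspace V}, forall v, v \in W <-> U v.
Proof.
move=> U0 UZ.
have [W [sWU maxW]] : exists W : {vspace V}, (forall v, v \in W -> U v) /\
    forall W' : {vspace V}, (forall v, v \in W' -> U v) -> (\dim W' <= \dim W)%N.
  have : exists W : {vspace V}, forall v, v \in W -> U v.
    by exists 0%VS => v; rewrite memv0 => /eqP ->.
  case=> W; have [m] := ubnP (\dim {:V} - \dim W); elim: m W => // m IH W.
  rewrite ltnS => le_m sWU.
  case: (classic (forall W' : {vspace V}, (forall v, v \in W' -> U v) ->
    (\dim W' <= \dim W)%N)) => [h|/not_all_ex_not[W' h]]; first by exists W.
  have [sW'U /negP] := imply_to_and _ _ h; rewrite -ltnNge => ltW.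
  apply: (IH W') => //; apply: leq_trans le_m; apply: ltn_sub2l => //.
  by apply: leq_trans ltW (dimvS (subvf _)).
exists W => v; split=> [/sWU //|Uv].
have /maxW : forall w, w \in (<[v]> + W)%VS -> U w.
  by move=> w /memv_addP[_ /vlineP[b ->] [w' /sWU Uw' ->]]; exact: UZ.
rewrite (geq_leqif (dimv_leqif_sup (addvSr _ _))).
by move/subvP; apply; rewrite memvE addvSl.
Qed.

(** * The group algebra and its trace form *)

Section GroupAlgebraTheory.
Variables (k : fieldType) (G : finGroupType).
Notation kG := (grpalg k G).
Implicit Types (u v w e f : kG) (g h : G) (lam : G -> k).

Lemma geltE g h : gelt k g h = (h == g)%:R.
Proof. by rewrite ffunE. Qed.

Lemma grpalg_mulE u v g : (u * v) g = \sum_h u h * v (h^-1 * g)%g.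
Proof. by rewrite ffunE. Qed.

Lemma gelt_mull g u h : (gelt k g * u) h = u (g^-1 * h)%g.
Proof.
rewrite grpalg_mulE (bigD1 g) //= geltE eqxx mul1r big1 ?addr0 // => i /negPf ig.
by rewrite geltE ig mul0r.
Qed.

Lemma gelt_mulr g u h : (u * gelt k g) h = u (h * g^-1)%g.
Proof.
rewrite grpalg_mulE (bigD1 (h * g^-1)%g) //= geltE invMg invgK -mulgA mulVg mulg1.
rewrite eqxx mulr1 big1 ?addr0 // => i ig; rewrite geltE.
case: eqP => [ig'|]; last by rewrite mulr0.
by move: ig; rewrite -ig' invMg invgK mulKVg eqxx.
Qed.

Lemma geltM g h : gelt k (g * h)%g = gelt k g * gelt k h.
Proof.
apply/ffunP=> i; rewrite gelt_mull !geltE; congr (_%:R).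
by congr nat_of_bool; rewrite (can2_eq (mulKVg g) (mulKg g)).
Qed.

Lemma gelt1 : gelt k 1%g = 1 :> kG. Proof. by []. Qed.

Lemma gelt_exp g i : gelt k (g ^+ i)%g = gelt k g ^+ i.
Proof. by elim: i => [|i IH] //; rewrite exprS -IH expgS geltM. Qed.

Lemma grpalg_sum u : u = \sum_g (u g : k) *: gelt k g.
Proof.
apply/ffunP=> h; rewrite sum_ffunE (bigD1 h) //= !ffunE eqxx [_ *: _]mulr1.
rewrite big1 ?addr0 // => g /negPf gh; rewrite !ffunE eq_sym gh; exact: mulr0.
Qed.

Lemma grpalg_at1C u v : (u * v) 1%g = (v * u) 1%g.
Proof.
rewrite !grpalg_mulE (reindex_inj invg_inj); apply: eq_bigr => g _ /=.
by rewrite !mulg1 invgK mulrC.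
Qed.

Definition conj_sum u : kG := \sum_g gelt k g^-1%g * u * gelt k g.

(** The trace of v |-> u v w on kG, see [trace_formE]. *)
Definition trace_form u w : k := (conj_sum u * w) 1%g.

Lemma conj_sum_gelt u h : conj_sum u * gelt k h = gelt k h * conj_sum u.
Proof.
rewrite mulr_suml mulr_sumr (reindex_inj (mulIg h^-1%g)); apply: eq_bigr => g _ /=.
by rewrite -!mulrA -geltM mulgKV invMg invgK geltM -!mulrA.
Qed.

Lemma conj_sumC u v : conj_sum u * v = v * conj_sum u.
Proof.
rewrite [v]grpalg_sum mulr_sumr mulr_suml; apply: eq_bigr => g _.
by rewrite -scalerAr -scalerAl conj_sum_gelt.
Qed.

(** Since conj_sum u is central, this is the symmetry of the coefficient at 1. *)
Lemma trace_formC u v w : trace_form u (v * w) = trace_form u (w * v).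
Proof. by rewrite /trace_form mulrA grpalg_at1C mulrA -conj_sumC -mulrA. Qed.

Lemma trace_form1 u : trace_form u 1 = #|G|%:R * u 1%g.
Proof.
rewrite /trace_form mulr1 /conj_sum sum_ffunE (eq_bigr (fun=> u 1%g)).
  by rewrite sumr_const mulr_natl.
by move=> g _; rewrite gelt_mulr gelt_mull invgK mul1g mulgV.
Qed.

Lemma trace_formE u w :
  trace_form u w = \sum_g (u * gelt k g * w) g.
Proof.
rewrite /trace_form /conj_sum mulr_suml sum_ffunE; apply: eq_bigr => g _.
by rewrite -mulrA -mulrA gelt_mull invgK mulg1 mulrA.
Qed.

Lemma trace_formDr u v w : trace_form u (v + w) = trace_form u v + trace_form u w.
Proof. by rewrite /trace_form mulrDr ffunE. Qed.

Lemma trace_form_suml u w : trace_form u w = \sum_g u g * trace_form (gelt k g) w.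
Proof.
rewrite trace_formE; under [RHS]eq_bigr => g _ do rewrite trace_formE mulr_sumr.
rewrite exchange_big; apply: eq_bigr => h _ /=.
rewrite {1}[u]grpalg_sum !mulr_suml sum_ffunE; apply: eq_bigr => g _.
by rewrite -!scalerAl ffunE.
Qed.

Lemma scale_gelt_sum (V : lmodType kG) u (m : V) :
  u *: m = \sum_g (u g : k)%:A *: (gelt k g *: m).
Proof.
rewrite {1}[u]grpalg_sum scaler_suml; apply: eq_bigr => g _.
by rewrite scalerA -scalerAl mul1r.
Qed.

Lemma has_character_ker (V : lmodType kG) lam u :
  has_character V lam -> (forall m : V, u *: m = 0) ->
  \sum_g u g * lam g = 0.
Proof.
case=> d [b [r [b_bij rb lamE]]] u0.
have coef0 i l : \sum_g u g * r g i l = 0.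
  have : \row_i (\sum_g u g * r g i l) = 0 :> 'rV[k]_d.
    apply: (bij_inj b_bij) => /=.
    rewrite [RHS]big1 => [|s _]; last by rewrite mxE scale0r scale0r.
    rewrite -[RHS](u0 (b l)) scale_gelt_sum.
    under [RHS]eq_bigr => g _ do rewrite rb scaler_sumr.
    rewrite exchange_big; apply: eq_bigr => s _ /=.
    rewrite mxE 2!scaler_suml; apply: eq_bigr => g _.
    by rewrite [RHS]scalerA -scalerAl mul1r scalerA.
  by move/rowP/(_ i); rewrite !mxE.
under eq_bigr => g _ do rewrite lamE mulr_sumr.
by rewrite exchange_big big1 // => i _; exact: coef0.
Qed.

End GroupAlgebraTheory.

(** * Left ideals generated by idempotents *)

Section LeftIdealModule.
Variables (k : fieldType) (A : falgType k) (e : A).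

Definition lideal_val (m : lideal e) : A := val m.

Lemma lideal_valZ a (m : lideal e) : lideal_val (a *: m) = a * lideal_val m.
Proof. by []. Qed.

Lemma lideal_valD (m1 m2 : lideal e) :
  lideal_val (m1 + m2) = lideal_val m1 + lideal_val m2.
Proof. by []. Qed.

Lemma lideal_val0 : lideal_val 0 = 0. Proof. by []. Qed.

Lemma lideal_val_inj : injective lideal_val. Proof. exact: val_inj. Qed.

Fact lideal_gen_subproof (a : A) : (a * e : A^o) \in lideal_pred e.
Proof. by apply/memv_imgP; exists a; rewrite ?memvf // lfunE. Qed.

Definition lideal_gen (a : A) : lideal e := Sub (a * e : A^o) (lideal_gen_subproof a).

Lemma lideal_genE a : lideal_val (lideal_gen a) = a * e.
Proof. by []. Qed.

Lemma lideal_val_comb (I : finType) (s : I -> k) (b : I -> lideal e) :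
  lideal_val (\sum_i (s i)%:A *: b i) = \sum_i s i *: lideal_val (b i).
Proof.
rewrite (big_morph _ lideal_valD lideal_val0).
by apply: eq_bigr => i _; rewrite lideal_valZ -scalerAl mul1r.
Qed.

Hypothesis ee : e * e = e.

Lemma lideal_valK (m : lideal e) : lideal_val m * e = lideal_val m.
Proof.
case: m => v /= /[dup] /memv_imgP[a _ va] vP; rewrite /lideal_val /= va lfunE /=.
by rewrite -mulrA ee.
Qed.

Lemma lideal_gen_scale (m : lideal e) : m = lideal_val m *: lideal_gen 1.
Proof. by apply: lideal_val_inj; rewrite lideal_valZ lideal_genE mul1r lideal_valK. Qed.

(** A map out of Ae is determined by the image of e, which lifts along any
    surjection. *)
Lemma lideal_projective : projective_mod (lideal e).
Proof.
move=> M N f g f_surj; have [m fm] := f_surj (g (lideal_gen 1)).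
pose h (u : lideal e) := lideal_val u *: m.
have h_lin : linear h.
  by move=> a u v; rewrite /h lideal_valD lideal_valZ scalerDl scalerA.
pose hL := GRing.isLinear.Build _ _ _ _ h h_lin.
pose h' : {linear lideal e -> M} := HB.pack h hL.
by exists h' => u; rewrite /= /h linearZ fm -linearZ -lideal_gen_scale.
Qed.
End LeftIdealModule.

Section Idempotents.
Variables (k : fieldType) (G : finGroupType).
Notation kG := (grpalg k G).
Implicit Types (u v w e f : kG) (g h : G) (lam : G -> k).

(** Left multiplication by g on kGe and v |-> g v e on kG have the same trace,
    because right multiplication by e is a projection onto kGe. *)
Lemma character_lidealE e lam : e * e = e ->
  has_character (lideal e) lam -> forall g, lam g = trace_form (gelt k g) e.
Proof.
move=> ee [d [b [r [[c bK cK] rb lamE]]]] g.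
pose bv i := lideal_val (b i).
pose co v := c (lideal_gen e v).
(* co v is the coordinate vector of v e in the given basis. *)
have coE v : v * e = \sum_i (co v 0 i : k) *: bv i.
  rewrite -lideal_genE -[in LHS](cK (lideal_gen e v)) /=.
  by rewrite lideal_val_comb.
have co_uniq (s t : 'rV[k]_d) :
    \sum_i s 0 i *: bv i = \sum_i t 0 i *: bv i -> s = t.
  move=> st; apply: (can_inj bK); apply: lideal_val_inj.
  by rewrite !lideal_val_comb.
have co_bv i : co (bv i) = delta_mx 0 i.
  apply: co_uniq; rewrite -coE lideal_valK // (bigD1 i) //= mxE !eqxx scale1r.
  by rewrite big1 ?addr0 // => l /negPf li; rewrite mxE eqxx li scale0r.
have co_sum v : co v = \sum_h (v h : k) *: co (gelt k h).
  apply: co_uniq; rewrite -coE {1}[v]grpalg_sum mulr_suml.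
  under eq_bigr => h _ do rewrite -scalerAl coE scaler_sumr.
  rewrite exchange_big; apply: eq_bigr => i _ /=.
  rewrite summxE scaler_suml; apply: eq_bigr => h _.
  by rewrite mxE scalerA.
have gbv l : gelt k g * bv l = \sum_i r g i l *: bv i.
  by rewrite -lideal_valZ rb lideal_val_comb.
rewrite trace_formE lamE.
transitivity (\sum_i \sum_l r g i l * (co (bv i)) 0 l).
  apply: eq_bigr => i _; rewrite (bigD1 i) //= co_bv mxE !eqxx mulr1.
  by rewrite big1 ?addr0 // => l /negPf li; rewrite mxE eqxx li mulr0.
under eq_bigr => i _ do under eq_bigr => l _ do
  rewrite co_sum summxE mulr_sumr.
under eq_bigr => i _ do rewrite exchange_big.
rewrite exchange_big; apply: eq_bigr => h _ /=.
rewrite -mulrA coE mulr_sumr sum_ffunE exchange_big; apply: eq_bigr => l _ /=.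
rewrite -scalerAr gbv scaler_sumr sum_ffunE; apply: eq_bigr => i _.
by rewrite mxE !ffunE mulrA mulrC.
Qed.

Lemma character_lideal_exists e : e * e = e ->
  has_character (lideal e) (fun g => trace_form (gelt k g) e).
Proof.
move=> ee; pose W := limg (amulr e); pose d := \dim W.
have WP v : v \in W -> v * e = v.
  by case/memv_imgP=> u _ ->; rewrite lfunE /= -mulrA ee.
pose bs := vbasis W.
have bsW i : bs`_i \in W.
  case: (ltnP i (size bs)) => hi; first by apply: vbasis_mem; apply: mem_nth.
  by rewrite nth_default // mem0v.
pose b (i : 'I_d) := lideal_gen e bs`_i.
pose r g : 'M[k]_d := \matrix_(i, l) coord bs i (gelt k g * bs`_l).
have bE i : lideal_val (b i) = bs`_i by rewrite lideal_genE WP.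
have sumE (s : 'I_d -> k) :
    lideal_val (\sum_i (s i)%:A *: b i) = \sum_i s i *: bs`_i.
  by rewrite lideal_val_comb; apply: eq_bigr => i _; rewrite bE.
have fr : free bs by apply: basis_free (vbasisP W).
have memW (m : lideal e) : lideal_val m \in W by exact: valP.
have spE v : v \in W -> v = \sum_i coord bs i v *: bs`_i by apply: coord_vbasis.
have hc : exists lam, has_character (lideal e) lam.
  exists (fun g => \tr (r g)), d, b, r; split=> [|g l|//].
    exists (fun m => \row_i coord bs i (lideal_val m)) => [c|m].
      by apply/rowP=> i; rewrite mxE sumE coord_sum_free.
    apply: lideal_val_inj; rewrite sumE [RHS]spE //; apply: eq_bigr => i _.
    by rewrite mxE.
  apply: lideal_val_inj; rewrite sumE lideal_valZ bE.
  have gW : gelt k g * bs`_l \in W.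
    rewrite -[bs`_l]WP // mulrA; apply/memv_imgP.
    by exists (gelt k g * bs`_l); rewrite ?memvf // lfunE.
  by rewrite {1}[_ * _]spE //; apply: eq_bigr => i _; rewrite mxE.
have [lam hlam] := hc; have lamE := character_lidealE ee hlam.
have [d' [b' [r' [h1 h2 h3]]]] := hlam.
by exists d', b', r'; split=> // g; rewrite -lamE.
Qed.

Definition left_ideal (U : kG -> Prop) :=
  U 0 /\ forall a u v, U u -> U v -> U (a * u + v).

Hypothesis G_unit : #|G|%:R != 0 :> k.

(** Maschke: averaging a linear projection onto U over G gives a kG-linear
    one, and its value at 1 is the right identity. *)
Lemma left_ideal_right_identity (U : kG -> Prop) : left_ideal U ->
  exists2 u, U u & forall v, U v -> v * u = v.
Proof.
case=> U0 UM.
have [|W WU] := submodule_vspace U0.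
  by move=> a u v Uu Uv; rewrite -[u]mul1r scalerAl; exact: UM.
have UA a u : U u -> U (a * u) by move=> Uu; rewrite -[_ * _]addr0; apply: UM.
pose P g := gelt k g^-1%g * projv W (gelt k g).
pose u := (#|G|%:R^-1 : k) *: \sum_g P g.
have uW : u \in W.
  apply/memvZ/memv_suml => g _; apply/WU/UA/WU; exact: memv_proj.
exists u => [|v Uv]; first exact/WU.
have hP h : gelt k h * (\sum_g P g) = \sum_g gelt k g^-1%g * projv W (gelt k (g * h)%g).
  rewrite mulr_sumr (reindex_inj (mulIg h)); apply: eq_bigr => g _ /=.
  by rewrite /P invMg geltM !mulrA -geltM mulgV gelt1 mul1r.
rewrite /u -scalerAr {1}[v]grpalg_sum mulr_suml.
under eq_bigr => h _ do rewrite -scalerAl hP scaler_sumr.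
rewrite exchange_big /=.
rewrite (eq_bigr (fun=> v)) => [|g _].
  by rewrite sumr_const -scaler_nat scalerA mulVf // scale1r.
under eq_bigr => h _ do rewrite geltM scalerAr -linearZ scalerAr.
rewrite -mulr_sumr -(linear_sum (projv W)) -mulr_sumr -grpalg_sum.
transitivity (gelt k g^-1%g * (gelt k g * v)).
  by congr (_ * _); exact/projv_id/WU/UA.
by rewrite mulrA -geltM mulVg gelt1 mul1r.
Qed.

(** If u is a right identity of U then e u is an idempotent of eUe, hence
    equal to 0 or to e. *)
Lemma primitive_left_ideal e (U : kG -> Prop) :
  primitive_idem e -> left_ideal U -> (forall v, U v -> v * e = v) ->
  (forall v, U v -> v = 0) \/ U e.
Proof.
case=> e0 ee eP lU Ue; have [u Uu uP] := left_ideal_right_identity lU.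
have UA a v : U v -> U (a * v) by case: lU => ? UM Uv; rewrite -[_ * _]addr0; apply: UM.
have eue : e * u * e = e * u by rewrite -mulrA Ue.
have euu : e * u * (e * u) = e * u by rewrite mulrA eue -mulrA uP.
have [|||||eu0|] := eP (e * u) (e - e * u); rewrite ?euu //.
- by rewrite mulrBl !mulrBr ee eue euu mulrA ee subrr subr0.
- by rewrite mulrBr eue euu subrr.
- by rewrite mulrBl euu mulrA ee subrr.
- by rewrite addrC subrK.
- by left=> v Uv; rewrite -(uP v Uv) -{1}(Ue v Uv) -mulrA eu0 mulr0.
- by move/eqP; rewrite subr_eq0 => /eqP ->; right; exact: UA.
Qed.

(** Nonzero maps between the simple modules kGe and kGf are isomorphisms: the
    elements a and b are the images of the generators under such an
    isomorphism and its inverse. *)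
Lemma primitive_factor e f w :
  primitive_idem e -> primitive_idem f -> f * w * e != 0 ->
  exists a b, [/\ b * a = e, a * b = f, a * e = a & f * a = a].
Proof.
move=> pe [f0 ff fP] fwe; have [e0 ee _] := pe; pose a := f * w * e.
have [||u0|[u eE]] := @primitive_left_ideal e (fun v => exists u, v = u * a) pe.
- split; first by exists 0; rewrite mul0r.
  by move=> s _ _ [u1 ->] [u2 ->]; exists (s * u1 + u2); rewrite mulrDl !mulrA.
- by move=> _ [u ->]; rewrite /a -!mulrA ee.
- by case/eqP: fwe; apply: u0; exists 1; rewrite mul1r.
have ae : a * e = a by rewrite /a -mulrA ee.
have fa : f * a = a by rewrite /a !mulrA ff.
have ba : e * u * f * a = e by rewrite -mulrA fa -mulrA -eE ee.
exists a, (e * u * f); split=> //.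
set b := e * u * f in ba *.
have fab : f * (a * b) = a * b by rewrite mulrA fa.
have abf : a * b * f = a * b by rewrite /b -!mulrA ff.
have abab : a * b * (a * b) = a * b by rewrite -mulrA (mulrA b) ba mulrA ae.
have [|||||ab0|] := fP (a * b) (f - a * b); rewrite ?abab //.
- by rewrite mulrBl !mulrBr ff fab abf abab subrr subr0.
- by rewrite mulrBr abf abab subrr.
- by rewrite mulrBl fab abab subrr.
- by rewrite addrC subrK.
- by case: e0; rewrite -ee -ba mulrA -(mulrA b) ab0 mulr0 mul0r.
- by move/eqP; rewrite subr_eq0 => /eqP.
Qed.

Lemma primitive_lideal_simple e : primitive_idem e -> simple_mod (lideal e).
Proof.
move=> pe; have [e0 ee _] := pe.
split.
  exists (lideal_gen e 1) => /(congr1 (@lideal_val _ _ e)).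
  by rewrite lideal_genE mul1r lideal_val0.
move=> U [U0 UM].
have [||h|[m Um me]] := @primitive_left_ideal e
  (fun v => exists2 m : lideal e, U m & lideal_val m = v) pe.
- split; first by exists 0.
  by move=> a _ _ [m1 Um1 <-] [m2 Um2 <-]; exists (a *: m1 + m2) => //; exact: UM.
- by move=> _ [m Um <-]; rewrite lideal_valK.
- by left=> m Um; apply: lideal_val_inj; apply: h; exists m.
- right=> n; have -> : n = lideal_val n *: m + 0.
    by apply: lideal_val_inj; rewrite addr0 lideal_valZ me lideal_valK.
  exact: UM.
Qed.
End Idempotents.

Lemma dim_orthogonal_summand (k : fieldType) (A : falgType k) (f g : A) :
    f * f = f -> g * g = g -> f * g = 0 -> g * f = 0 -> g <> 0 ->
  (\dim (limg (amulr f)) < \dim (limg (amulr (f + g)%R)))%N.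
Proof.
move=> ff gg fg gf g0.
have sub : (limg (amulr f) <= limg (amulr (f + g)%R))%VS.
  apply/subvP=> _ /memv_imgP[v _ ->]; apply/memv_imgP.
  exists (v * f); first exact: memvf.
  by rewrite !lfunE /= -mulrA mulrDr ff fg addr0.
rewrite (ltn_leqif (dimv_leqif_sup sub)); apply/negP=> /subvP sub'.
have /sub' : g \in limg (amulr (f + g)).
  apply/memv_imgP; exists g; first exact: memvf.
  by rewrite lfunE /= mulrDr gg gf add0r.
move=> /memv_imgP[v _]; rewrite lfunE /= => gE.
by apply: g0; rewrite gE -ff mulrA -gE.
Qed.

(** Splitting an idempotent into orthogonal ones strictly decreases the
    dimension of its left ideal, so the splitting ends with primitive
    idempotents. *)
Lemma idempotent_ind (k : fieldType) (A : falgType k) (P : A -> Prop) :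
    P 0 -> (forall f, primitive_idem f -> P f) ->
    (forall f g, P f -> P g -> P (f + g)) ->
  forall f : A, f * f = f -> P f.
Proof.
move=> P0 Pprim PD f; have [m] := ubnP (\dim (limg (amulr f))).
elim: m f => // m IH f; rewrite ltnS => le_m ff.
case: (classic (f = 0)) => [->//|f0].
case: (classic (primitive_idem f)) => [/Pprim //|nprim].
have [f1 [f2 [i1 i2 [o12 o21] [fE [n1 n2]]]]] : exists f1 f2 : A,
    [/\ f1 * f1 = f1, f2 * f2 = f2, f1 * f2 = 0 /\ f2 * f1 = 0
      & f = f1 + f2 /\ (f1 <> 0 /\ f2 <> 0)].
  apply: NNPP => h; apply: nprim; split=> // f1 f2 i1 i2 o12 o21 fE.
  apply: NNPP => /not_or_and[n1 n2]; apply: h.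
  by exists f1, f2; split.
rewrite fE; apply: PD; apply: IH => //; apply: leq_trans le_m; rewrite fE.
  exact: dim_orthogonal_summand.
by rewrite addrC; exact: dim_orthogonal_summand.
Qed.

(** * Simple modules are determined by their characters *)

Section Characters.
Variables (k : fieldType) (G : finGroupType).
Notation kG := (grpalg k G).
Implicit Types (u v w e f : kG) (g h : G) (lam mu : G -> k).

Lemma eq_has_character (V : lmodType kG) lam mu :
  lam =1 mu -> has_character V lam -> has_character V mu.
Proof.
by move=> lm [d [b [r [h1 h2 h3]]]]; exists d, b, r; split=> // g; rewrite -lm.
Qed.

Lemma idem_assocE lam e :
  idem_assoc lam e <->
  primitive_idem e /\ lam =1 (fun g => trace_form (gelt k g) e).
Proof.
split=> [[pe he]|[pe lamE]]; split=> //; have [e0 ee _] := pe.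
  exact: character_lidealE.
by apply: eq_has_character (character_lideal_exists ee) => g; rewrite lamE.
Qed.

Hypothesis G_unit : #|G|%:R != 0 :> k.

(** If e acted as zero on V then so would its two-sided ideal B, and the
    common character would vanish on B; thus trace_form (u e) e = 0 for all u.
    A primitive idempotent f either has e kG f = 0, or f = a b with b a = e,
    which replaces f by e in the form.  So trace_form (u e) f = 0 for
    primitive f, hence for f = 1, and |G| (u e)(1) = 0 for all u, that is
    e = 0. *)
Lemma idem_assoc_act (V : lmodType kG) lam e :
  has_character V lam -> idem_assoc lam e -> exists m : V, e *: m != 0.
Proof.
move=> hV /idem_assocE[pe lamE]; have [e0 ee _] := pe.
apply: NNPP => eV; have {}eV (m : V) : e *: m = 0.
  by apply/eqP/negPn/negP=> em; apply: eV; exists m.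
have tr0 u w : trace_form (u * e * w) e = 0.
  rewrite trace_form_suml -[RHS](@has_character_ker _ _ V lam (u * e * w) hV).
    by apply: eq_bigr => g _; rewrite lamE.
  by move=> m; rewrite -!scalerA eV scaler0.
have tr1 u : trace_form (u * e) 1 = 0.
  move: u; apply: (idempotent_ind (P := fun f => forall u, trace_form (u * e) f = 0)).
  - by move=> u; rewrite /trace_form mulr0 ffunE.
  - move=> f pf u; case: (classic (exists w, f * w * e != 0)) => [[w fwe]|h].
      have [a [b [ba ab ae fa]]] := primitive_factor G_unit pe pf fwe.
      by rewrite -ab trace_formC ba -[u * e]mulr1 tr0.
    have fGe w : e * w * f = 0.
      apply/eqP/negPn/negP=> ewf; apply: h.
      have [a [b [ba ab ae fa]]] := primitive_factor G_unit pf pe ewf.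
      exists b; rewrite -ab -ba; apply/eqP=> h; case: e0.
      rewrite -ee -{1}ab -{1}ae -ba -ab.
      have -> : a * (b * a) * b * (a * b) = a * (b * a * b * (a * b)) by rewrite !mulrA.
      by rewrite h mulr0.
    rewrite trace_formE big1 // => g _.
    by rewrite -!mulrA (mulrA e) fGe mulr0 ffunE.
  - by move=> f g hf hg u; rewrite trace_formDr hf hg addr0.
  - exact: mulr1.
apply: e0; apply/ffunP=> g; rewrite ffunE.
have := tr1 (gelt k g^-1%g); rewrite trace_form1 gelt_mull invgK mulg1 => /eqP.
by rewrite mulf_eq0 (negPf G_unit) => /eqP.
Qed.

Lemma idem_assoc_link lam e f :
  idem_assoc lam e -> idem_assoc lam f -> exists w, f * w * e != 0.
Proof.
move=> he /(idem_assoc_act he.2)[m fm]; exists (lideal_val m).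
apply: contra fm => /eqP fme; have [_ ee _] := he.1.
by apply/eqP/lideal_val_inj; rewrite lideal_valZ -[lideal_val m](lideal_valK ee) mulrA.
Qed.

Lemma link_eq_character lam mu e f w : idem_assoc lam e -> idem_assoc mu f ->
  f * w * e != 0 -> mu =1 lam.
Proof.
move=> /idem_assocE[pe lamE] /idem_assocE[pf muE] fwe g.
have [a [b [ba ab _ _]]] := primitive_factor G_unit pe pf fwe.
by rewrite muE lamE -ab -ba trace_formC.
Qed.
End Characters.

(** * Twisting by a linear character *)

Section Twist.
Variables (k : fieldType) (G : finGroupType).
Notation kG := (grpalg k G).
Implicit Types (u v w e f : kG) (g h : G) (lam chi : G -> k).

Definition gtwist chi u : kG := [ffun g => chi g * u g].

Section Linear.
Variable chi : G -> k.
Hypothesis chiL : linear_character chi.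

Lemma lin_charV g : chi g^-1%g * chi g = 1.
Proof. by rewrite -chiL.2 mulVg chiL.1. Qed.

Lemma lin_char_neq0 g : chi g != 0.
Proof. by apply/eqP=> g0; have /eqP := lin_charV g; rewrite g0 mulr0 eq_sym oner_eq0. Qed.

Lemma lin_charVE g : chi g^-1%g = (chi g)^-1.
Proof. by apply: (mulIf (lin_char_neq0 g)); rewrite lin_charV mulVf ?lin_char_neq0. Qed.

Lemma lin_charXV i : linear_character (fun g => chi g ^- i).
Proof.
split=> [|g h]; first by rewrite chiL.1 expr1n invr1.
by rewrite chiL.2 exprMn invfM.
Qed.

Lemma gtwistM u v : gtwist chi (u * v) = gtwist chi u * gtwist chi v.
Proof.
apply/ffunP=> g; rewrite ffunE !grpalg_mulE mulr_sumr; apply: eq_bigr => h _.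
by rewrite !ffunE mulrACA -chiL.2 mulKVg.
Qed.

Lemma gtwist_gelt g : gtwist chi (gelt k g) = chi g *: gelt k g.
Proof.
apply/ffunP=> h; rewrite !ffunE; case: eqP => [->|_] //.
by rewrite mulr0 [RHS]mulr0.
Qed.

Lemma trace_form_gtwist h w :
  trace_form (gelt k h) (gtwist chi w) = chi h^-1%g * trace_form (gelt k h) w.
Proof.
rewrite !trace_formE mulr_sumr; apply: eq_bigr => g _.
rewrite -geltM !gelt_mull ffunE; congr (_ * _).
rewrite invMg -mulgA !chiL.2 mulrCA -{2}[chi h^-1%g]mulr1; congr (_ * _).
by rewrite lin_charV.
Qed.
End Linear.

Lemma gtwistD chi u v : gtwist chi (u + v) = gtwist chi u + gtwist chi v.
Proof. by apply/ffunP=> g; rewrite !ffunE mulrDr. Qed.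

Lemma gtwistZ chi (c : k) u : gtwist chi (c *: u) = c *: gtwist chi u.
Proof. by apply/ffunP=> g; rewrite !ffunE; exact: mulrCA. Qed.

Lemma gtwist0 chi : gtwist chi 0 = 0.
Proof. by apply/ffunP=> g; rewrite !ffunE mulr0. Qed.

Lemma gtwist_sum chi (I : finType) (F : I -> kG) :
  gtwist chi (\sum_i F i) = \sum_i gtwist chi (F i).
Proof. exact: (big_morph _ (gtwistD chi) (gtwist0 chi)). Qed.

Lemma gtwistK chi psi u : (forall g, psi g * chi g = 1) -> gtwist psi (gtwist chi u) = u.
Proof. by move=> h; apply/ffunP=> g; rewrite !ffunE mulrA h mul1r. Qed.

(** The automorphism of kG with x^i u = (shift chi i u) x^i in H; the inverse
    of chi is what makes the character of kG (shift chi i e) equal to that of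
    kGe times chi^i. *)
Definition shift chi (i : nat) u := gtwist (fun g => chi g ^- i) u.

Lemma shift0 chi u : shift chi 0 u = u.
Proof. by apply/ffunP=> g; rewrite ffunE invr1 mul1r. Qed.

Lemma shiftS chi i u : shift chi i.+1 u = shift chi 1 (shift chi i u).
Proof. by apply/ffunP=> g; rewrite !ffunE mulrA exprS invfM. Qed.

Variable chi : G -> k.
Hypothesis chiL : linear_character chi.

Definition unshift i u := gtwist (fun g => chi g ^+ i) u.

Lemma shiftK i : cancel (shift chi i) (unshift i).
Proof. by move=> u; apply: gtwistK => g; rewrite mulfV // expf_neq0 // lin_char_neq0. Qed.

Lemma unshiftK i : cancel (unshift i) (shift chi i).
Proof. by move=> u; apply: gtwistK => g; rewrite mulVf // expf_neq0 // lin_char_neq0. Qed.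

Lemma lin_charX i : linear_character (fun g => chi g ^+ i).
Proof.
split=> [|g h]; first by rewrite chiL.1 expr1n.
by rewrite chiL.2 exprMn.
Qed.

Lemma shiftM i u v : shift chi i (u * v) = shift chi i u * shift chi i v.
Proof. exact/gtwistM/lin_charXV. Qed.

Lemma unshiftM i u v : unshift i (u * v) = unshift i u * unshift i v.
Proof. exact/gtwistM/lin_charX. Qed.

Lemma shift_primitive i e : primitive_idem e -> primitive_idem (shift chi i e).
Proof.
move=> [e0 ee eP]; split.
- by move=> h; apply: e0; rewrite -[e](shiftK i) h /unshift gtwist0.
- by rewrite -shiftM ee.
move=> f g ff gg fg gf eE.
have [|||||h|h] := eP (unshift i f) (unshift i g).
- by rewrite -unshiftM ff.
- by rewrite -unshiftM gg.
- by rewrite -unshiftM fg /unshift gtwist0.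
- by rewrite -unshiftM gf /unshift gtwist0.
- by rewrite /unshift -gtwistD -/(unshift i _) -eE shiftK.
- by left; rewrite -[f](unshiftK i) h /shift gtwist0.
- by right; rewrite -[g](unshiftK i) h /shift gtwist0.
Qed.

Lemma shift_idem_assoc lam e i :
  idem_assoc lam e -> idem_assoc (twist lam chi i) (shift chi i e).
Proof.
move=> /idem_assocE[pe lamE]; apply/idem_assocE; split=> [|g].
  exact: shift_primitive.
rewrite /twist /shift trace_form_gtwist; last exact: lin_charXV.
by rewrite lin_charVE // exprVn invrK lamE mulrC.
Qed.
End Twist.

(** * Coefficients with respect to the powers of x *)

Lemma dim_ffun (k : fieldType) (I : finType) (V : vectType k) :
  \dim {:{ffun I -> V}} = (#|I| * \dim {:V})%N.
Proof. by rewrite !dimvf. Qed.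

Section Coefficients.
Variables (k : fieldType) (G : finGroupType) (A : falgType k).
Notation kG := (grpalg k G).
Variables (j : {lrmorphism kG -> A}) (x : A) (n : nat).
Notation jg g := (j (gelt k g)).
Implicit Types (u v w : kG) (g : G) (h : A).

Definition xpoly (v : {ffun 'I_n -> kG}) : A := \sum_i j (v i) * x ^+ i.

Fact xpoly_is_linear : linear xpoly.
Proof.
move=> c u v; rewrite /xpoly scaler_sumr -big_split; apply: eq_bigr => i _ /=.
by rewrite !ffunE linearP mulrDl scalerAl.
Qed.
HB.instance Definition _ := GRing.isLinear.Build k {ffun 'I_n -> kG} A _ xpoly xpoly_is_linear.

(** Indexed by all natural numbers, with value 0 from n on, so that the formula
    for the coefficients of Delta in [tcoef_comul] needs no range condition. *)
Definition xcoef (i : nat) h : kG :=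
  if insub i is Some i' then ((linfun xpoly)^-1%VF h) i' else 0.

Fact xcoef_is_linear i : linear (xcoef i).
Proof.
move=> c u v; rewrite /xcoef; case: insub => [i'|]; last by rewrite scaler0 addr0.
by rewrite linearP !ffunE.
Qed.
HB.instance Definition _ i := GRing.isLinear.Build k A kG _ (xcoef i) (xcoef_is_linear i).

Hypothesis basisA : basis_of {:A} [seq jg g * x ^+ i | g <- enum G, i <- iota 0 n].

(** Onto because its image contains the basis of A, and the dimensions agree. *)
Lemma xpoly_bij : (lker (linfun xpoly) == 0%VS) && (limg (linfun xpoly) == fullv).
Proof.
have full : limg (linfun xpoly) = fullv.
  apply/eqP; rewrite eqEsubv subvf /= -(span_basis basisA); apply/span_subvP.
  move=> v /allpairsP[[g i] [_]]; rewrite mem_iota add0n /= => lt_in -> {v}.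
  apply/memv_imgP.
  exists [ffun l => if l == Ordinal lt_in then gelt k g else 0]; first exact: memvf.
  rewrite lfunE /= /xpoly (bigD1 (Ordinal lt_in)) //= ffunE eqxx.
  rewrite big1 ?addr0 // => l /negPf ln; by rewrite ffunE ln rmorph0 mul0r.
rewrite full eqxx andbT -dimv_eq0.
have := limg_ker_dim (linfun xpoly) fullv.
rewrite capfv full dim_ffun card_ord dim_ffun.
have -> : \dim {:A} = (n * #|G|)%N.
  have /eqnP := basis_free basisA; rewrite (span_basis basisA) => ->.
  rewrite size_allpairs -cardE size_iota mulnC.
  done.
by rewrite dimvf /= /dim /= muln1 => /eqP; rewrite -[X in _ == X]add0n eqn_add2r.
Qed.

Lemma xcoef_sum (v : nat -> kG) l : (l < n)%N ->
  xcoef l (\sum_(i < n) j (v i) * x ^+ i) = v l.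
Proof.
move=> lt_ln; have /andP[ker0 _] := xpoly_bij.
have -> : \sum_(i < n) j (v i) * x ^+ i = linfun xpoly [ffun i => v (val i)].
  by rewrite lfunE; apply: eq_bigr => i _; rewrite ffunE.
by rewrite /xcoef insubT (lker0_lfunK ker0) ffunE.
Qed.

Lemma xcoefE h : h = \sum_(i < n) j (xcoef i h) * x ^+ i.
Proof.
have /andP[_ /eqP full] := xpoly_bij.
have hI : h \in limg (linfun xpoly) by rewrite full memvf.
rewrite -[LHS](limg_lfunVK hI) lfunE; apply: eq_bigr => i _.
by rewrite /xcoef valK.
Qed.

Lemma xcoef_out l h : (n <= l)%N -> xcoef l h = 0.
Proof. by move=> le_nl; rewrite /xcoef insubF // ltnNge le_nl. Qed.

Lemma xcoef_inj h h' : (forall i, (i < n)%N -> xcoef i h = xcoef i h') -> h = h'.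
Proof.
move=> eqh; rewrite [h]xcoefE [RHS]xcoefE; apply: eq_bigr => i _.
by rewrite eqh.
Qed.

Lemma xcoef_jl l u h : xcoef l (j u * h) = u * xcoef l h.
Proof.
case: (ltnP l n) => [lt_ln|le_nl]; last by rewrite !xcoef_out // mulr0.
rewrite [in LHS](xcoefE h) mulr_sumr.
under eq_bigr => i _ do rewrite mulrA -rmorphM.
by rewrite (xcoef_sum (fun i => u * xcoef i h)).
Qed.

Lemma xcoef_monom l u i : (i < n)%N -> xcoef l (j u * x ^+ i) = if l == i then u else 0.
Proof.
move=> lt_in; case: (ltnP l n) => [lt_ln|le_nl]; last first.
  by rewrite xcoef_out //; case: eqP le_nl => // ->; rewrite leqNgt lt_in.
have -> : j u * x ^+ i = \sum_(s < n) j (if val s == i then u else 0) * x ^+ s.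
  rewrite (bigD1 (Ordinal lt_in)) //= eqxx big1 ?addr0 // => s.
  by rewrite -val_eqE /= => /negPf ->; rewrite rmorph0 mul0r.
by rewrite (xcoef_sum (fun s => if s == i then u else 0)).
Qed.

Lemma xcoef_j l u : (0 < n)%N -> xcoef l (j u) = if l == 0%N then u else 0.
Proof. by move=> n0; rewrite -[j u]mulr1 -(expr0 x) xcoef_monom. Qed.

End Coefficients.

(** * Tensors in coordinates *)

Lemma linear_comb (k : fieldType) (U V : lmodType k) (f : U -> V) (I : finType)
    (c : I -> k) (b : I -> U) : linear f ->
  f (\sum_i c i *: b i) = \sum_i c i *: f (b i).
Proof.
move=> fL; have f0 : f 0 = 0.
  by have := fL (-1) 0 0; rewrite scaler0 addr0 scaleN1r addNr.
apply: (big_ind2 (fun u v => f u = v)) => // [u1 v1 u2 v2 <- <-|i _].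
  by rewrite -[u1]scale1r fL !scale1r.
by rewrite -[c i *: b i]addr0 fL f0 addr0.
Qed.

Section TensorTheory.
Variables (k : fieldType) (U V : vectType k).
Implicit Types (u : U) (v : V).

Lemma tensDl u1 u2 v : tens (u1 + u2) v = tens u1 v + tens u2 v.
Proof. by apply/matrixP=> i j; rewrite !mxE linearD mulrDl. Qed.

Lemma tensDr u v1 v2 : tens u (v1 + v2) = tens u v1 + tens u v2.
Proof. by apply/matrixP=> i j; rewrite !mxE linearD mulrDr. Qed.

Lemma tensZl (c : k) u v : tens (c *: u) v = c *: tens u v.
Proof. by apply/matrixP=> i j; rewrite !mxE linearZ mulrA. Qed.

Lemma tensZr (c : k) u v : tens u (c *: v) = c *: tens u v.
Proof. by apply/matrixP=> i j; rewrite !mxE linearZ mulrCA. Qed.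

Lemma tens0l v : tens (0 : U) v = 0.
Proof. by apply/matrixP=> i j; rewrite !mxE linear0 mul0r. Qed.

Lemma tens0r u : tens u (0 : V) = 0.
Proof. by apply/matrixP=> i j; rewrite !mxE linear0 mulr0. Qed.

Variables (W : vectType k) (f : U -> V -> W).

Fact tlift_is_linear : linear (tlift f).
Proof.
move=> c s t; rewrite /tlift scaler_sumr -big_split; apply: eq_bigr => i _ /=.
rewrite scaler_sumr -big_split; apply: eq_bigr => l _ /=.
by rewrite !mxE scalerDl scalerA.
Qed.

Lemma tlift_comb (c : k) (f1 f2 : U -> V -> W) t :
    (forall u v, f u v = c *: f1 u v + f2 u v) ->
  tlift f t = c *: tlift f1 t + tlift f2 t.
Proof.
move=> fE; rewrite /tlift scaler_sumr -big_split; apply: eq_bigr => i _ /=.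
rewrite scaler_sumr -big_split; apply: eq_bigr => l _ /=.
by rewrite fE scalerDr !scalerA mulrC.
Qed.

Hypotheses (f_l : forall v, linear (f^~ v)) (f_r : forall u, linear (f u)).

Lemma tlift_tens u v : tlift f (tens u v) = f u v.
Proof.
rewrite [in RHS](coord_vbasis (memvf u)) (linear_comb _ _ (f_l v)); apply: eq_bigr => i _.
rewrite [in RHS](coord_vbasis (memvf v)) (linear_comb _ _ (f_r _)) scaler_sumr.
apply: eq_bigr => l _.
by rewrite mxE scalerA.
Qed.

End TensorTheory.

Lemma mem_tens_vs (k : fieldType) (U V : vectType k) (X : {vspace U}) (Y : {vspace V}) u v :
  u \in X -> v \in Y -> tens u v \in tens_vs X Y.
Proof.
move=> /coord_vbasis -> /coord_vbasis ->.
rewrite (big_morph (fun w => tens w _) (fun u1 u2 => tensDl u1 u2 _) (tens0l _ _)).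
apply: memv_suml => i _; rewrite tensZl; apply: memvZ.
rewrite (big_morph _ (tensDr _) (tens0r _ _)).
apply: memv_suml => l _; rewrite tensZr; apply: memvZ; apply: memv_span.
apply/allpairsP; exists ((vbasis X)`_i, (vbasis Y)`_l).
by split=> //=; apply: mem_nth; rewrite size_tuple.
Qed.

Lemma tens_vs_ind (k : fieldType) (U V : vectType k) (X : {vspace U}) (Y : {vspace V})
    (W : {vspace tensor U V}) :
  (forall u v, u \in X -> v \in Y -> tens u v \in W) -> (tens_vs X Y <= W)%VS.
Proof.
move=> h; apply/span_subvP => _ /allpairsP[[u v] [uX vY ->]].
by apply: h; exact: vbasis_mem.
Qed.

Section TensorAlgebra.
Variables (k : fieldType) (A B : falgType k).
Implicit Types (s t : tensor A B).

Lemma tmul_linear_r s : linear (tmul s).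
Proof.
by move=> c t1 t2; apply: tlift_comb => u v; rewrite tlift_is_linear.
Qed.

HB.instance Definition _ s :=
  GRing.isLinear.Build k (tensor A B) (tensor A B) _ (tmul s) (tmul_linear_r s).

Lemma tmul_linear_l t : linear (fun s => tmul s t).
Proof. by move=> c s1 s2; exact: tlift_is_linear. Qed.

Lemma tmul_tens (u u' : A) (v v' : B) :
  tmul (tens u v) (tens u' v') = tens (u * u') (v * v').
Proof.
have in_tens (u1 : A) (v1 : B) :
    tlift (fun u2 v2 => tens (u1 * u2) (v1 * v2)) (tens u' v') = tens (u1 * u') (v1 * v').
  apply: tlift_tens => [v2|u2] c w1 w2 /=.
    by rewrite mulrDr -scalerAr tensDl tensZl.
  by rewrite mulrDr -scalerAr tensDr tensZr.
rewrite /tmul; rewrite tlift_tens ?in_tens // => [v2|u2] c w1 w2 /=; rewrite !in_tens.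
  by rewrite mulrDl -scalerAl tensDl tensZl.
by rewrite mulrDl -scalerAl tensDr tensZr.
Qed.
End TensorAlgebra.

(** * The comultiplication *)

(** Gaussian binomial coefficients in the parameter r, by the Pascal rule. *)
Fixpoint qbin (k : fieldType) (r : k) (i l : nat) : k :=
  match i, l with
  | _, 0%N => 1
  | 0%N, _.+1 => 0
  | i'.+1, l'.+1 => qbin r i' l' + r ^+ l * qbin r i' l
  end.

Lemma qbin0 (k : fieldType) (r : k) i : qbin r i 0 = 1.
Proof. by case: i. Qed.

Lemma qbin_gt (k : fieldType) (r : k) i l : (i < l)%N -> qbin r i l = 0.
Proof.
elim: i l => [|i IH] [|l] //= il.
by rewrite !IH ?mulr0 ?addr0 // ltnW.
Qed.

Lemma qbinn (k : fieldType) (r : k) i : qbin r i i = 1.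
Proof. by elim: i => //= i ->; rewrite qbin_gt // mulr0 addr0. Qed.

(** The q-binomial theorem for the summands x (x) a and 1 (x) x, which
    commute up to the scalar r. *)
Lemma tpow_skew (k : fieldType) (A : falgType k) (x a : A) (r : k) i :
  x * a = r *: (a * x) ->
  tpow (tens x a + tens 1 x) i =
  \sum_(l < i.+1) qbin r i l *: tens (x ^+ l) (a ^+ l * x ^+ (i - l)).
Proof.
move=> xa; have xal l : x * a ^+ l = r ^+ l *: (a ^+ l * x).
  elim: l => [|l IH]; first by rewrite !expr0 mulr1 mul1r scale1r.
  rewrite [in LHS]exprSr [LHS]mulrA IH -scalerAl -[_ * x * a]mulrA xa -scalerAr scalerA.
  by rewrite -exprSr mulrA -exprSr.
elim: i => [|i IH].
  by rewrite big_ord1 /= !expr0 scale1r mulr1.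
rewrite [LHS]/= -/(tpow _ _) IH.
have tmulDl s1 s2 t : tmul (s1 + s2) t = tmul s1 t + tmul s2 t :> tensor A A.
  by rewrite -[s1]scale1r tmul_linear_l !scale1r.
rewrite tmulDl !(linear_comb _ _ (tmul_linear_r _)).
under eq_bigr => l _ do rewrite tmul_tens mulrA -!exprS.
under [X in _ + X]eq_bigr => l _ do
  rewrite tmul_tens mul1r mulrA xal -scalerAl tensZr -mulrA -exprS scalerA.
rewrite [RHS]big_ord_recl [X in _ + X = _]big_ord_recl.
rewrite [X in X + _ = _]big_ord_recr [X in _ = _ + X]big_ord_recr.
rewrite !qbin0 /= !subn0 !subnn.
have b1 (l : nat) : bump 0 l = l.+1 by [].
rewrite b1 add0n (qbin_gt _ (ltnSn i)) mulr0 addr0 mul1r expr0 addrCA; congr (_ + _).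
rewrite addrAC -big_split; congr (_ + _); apply: eq_bigr => l _ /=.
by rewrite b1 add0n subSS scalerDl -subSn // mulrC.
Qed.

Section Comultiplication.
Variables (k : fieldType) (G : finGroupType) (H : hopfAlg k).
Notation kG := (grpalg k G).
Variables (j : {lrmorphism kG -> H}) (x : H) (n : nat) (a : G) (q : k).
Notation jg g := (j (gelt k g)).
Implicit Types (u v w : H) (g h : G).

Hypotheses (basisH : gx_basis j x n) (hopfH : gx_hopf j x a n).
Hypothesis n_gt0 : (0 < n)%N.
Hypothesis xa : x * jg a = q *: (jg a * x).

Notation xc := (xcoef j x n).

(** The coefficient of g x^r (x) h x^s. *)
Definition tcoef (r s : nat) (g h : G) : tensor H H -> k :=
  tlift (W := k^o) (fun u v => xc r u g * xc s v h).

Fact tcoef_is_linear r s g h : linear (tcoef r s g h : tensor H H -> k^o).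
Proof. exact: tlift_is_linear. Qed.

Lemma tcoef_is_linearZ r s g h (c : k) t :
  tcoef r s g h (c *: t) = c * tcoef r s g h t.
Proof.
have := linear_comb (fun=> c) (fun=> t) (@tcoef_is_linear r s g h) (I := 'I_1).
by rewrite !big_ord1.
Qed.

Lemma tcoef_tens r s g h u v : tcoef r s g h (tens u v) = xc r u g * xc s v h.
Proof.
rewrite /tcoef tlift_tens // => [w|w] c u1 u2 /=; rewrite linearP !ffunE.
  by rewrite mulrDl -mulrA.
by rewrite mulrDr mulrCA.
Qed.

Lemma basis_expansion u : u = \sum_g \sum_(i < n) xc i u g *: (jg g * x ^+ i).
Proof.
rewrite exchange_big [LHS](xcoefE basisH); apply: eq_bigr => i _.
rewrite [in LHS](grpalg_sum (xc i u)) linear_sum mulr_suml; apply: eq_bigr => g _.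
by rewrite linearZ /= scalerAl.
Qed.

Lemma comul_monom g i : (i < n)%N ->
  comul H (jg g * x ^+ i) =
  \sum_(l < i.+1) qbin q i l *: tens (jg g * x ^+ l) (jg (g * a ^+ l)%g * x ^+ (i - l)).
Proof.
move=> lt_in; have [-> _ _] := hopfH g lt_in.
rewrite (tpow_skew _ xa) (linear_comb _ _ (tmul_linear_r _)).
apply: eq_bigr => l _; rewrite tmul_tens mulrA; congr (_ *: tens _ (_ * _)).
rewrite -rmorphXn -rmorphM; congr (j _).
by rewrite -gelt_exp geltM.
Qed.

(** Only the monomial g x^(r+s) of u contributes, through the term l = r of the
    q-binomial formula. *)
Lemma tcoef_comul r s g h u :
  tcoef r s g h (comul H u) =
  qbin q (r + s) r * xc (r + s) u g * (h == g * a ^+ r)%g%:R.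
Proof.
pose F w := qbin q (r + s) r * xc (r + s) w g * (h == g * a ^+ r)%g%:R : k^o.
have FL : linear F.
  move=> c w1 w2; transitivity (c * F w1 + F w2) => //.
  by rewrite /F linearP !ffunE mulrDr mulrDl mulrCA -!mulrA.
have DL : linear (fun w => tcoef r s g h (comul H w) : k^o).
  by move=> c w1 w2; rewrite linearP tcoef_is_linear.
rewrite -/(F u) [u]basis_expansion.
have FL0 (f : H -> k^o) : linear f -> forall (I : finType) (b : I -> H),
    f (\sum_i b i) = \sum_i f (b i).
  move=> fL I b; rewrite -[RHS](eq_bigr _ (fun i _ => scale1r (f (b i)))).
  by rewrite -(linear_comb _ _ fL); congr f; apply: eq_bigr => i _; rewrite scale1r.
rewrite (FL0 _ FL) (FL0 _ DL); apply: eq_bigr => g0 _.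
rewrite (linear_comb _ _ FL) (linear_comb _ _ DL); apply: eq_bigr => -[i lt_in] _ /=.
congr (_ * _); rewrite comul_monom // (linear_comb _ _ (@tcoef_is_linear r s g h)) /F.
rewrite xcoef_monom //.
have term (l : 'I_i.+1) :
    tcoef r s g h (tens (jg g0 * x ^+ l) (jg (g0 * a ^+ l)%g * x ^+ (i - l))) =
    ((r == l) && (s == i - l)%N)%:R * ((g == g0)%:R * (h == g0 * a ^+ l)%g%:R).
  have lt_ln : (l < n)%N := leq_trans (ltn_ord l) lt_in.
  rewrite tcoef_tens !xcoef_monom //; last by apply: leq_ltn_trans lt_in; exact: leq_subr.
  case: (r == l); case: (s == _); rewrite /= ?geltE ?ffunE ?mul0r ?mulr0 ?mul1r //.
under eq_bigr => l _ do rewrite term.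
case: ((r + s)%N =P i) => [rsi|nrs]; last first.
  rewrite ffunE mulr0 mul0r big1 // => l _.
  case: eqP => [rl|]; last by rewrite !mul0r scaler0.
  case: eqP => [sl|]; last by rewrite !mul0r scaler0.
  by case: nrs; rewrite rl sl subnKC // -ltnS.
have lt_ri : (r < i.+1)%N by rewrite ltnS -rsi leq_addr.
have isr : (i - r = s)%N by rewrite -rsi addKn.
rewrite (bigD1 (Ordinal lt_ri)) //= isr !eqxx mul1r big1 ?addr0.
  rewrite geltE rsi -mulrA; congr (_ * _).
  by case: eqP => [->|]; rewrite ?mul0r.
by move=> l; rewrite -val_eqE eq_sym /= => /negPf ->; rewrite mul0r scaler0.
Qed.
End Comultiplication.

(** * The coradical, rank one and skew primitive elements *)

(** N functionals that vanish on R and are dual to N vectors of C show that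
    the codimension of R in C is at least N. *)
Lemma dimv_dual_family (k : fieldType) (V : vectType k) (R C : {vspace V}) (N : nat)
    (w : 'I_N -> V) (psi : 'I_N -> V -> k^o) :
    (forall i, linear (psi i)) -> (R <= C)%VS -> (forall i, w i \in C) ->
    (forall i v, v \in R -> psi i v = 0) ->
    (forall i l, psi i (w l) = (i == l)%:R) ->
  (\dim R + N <= \dim C)%N.
Proof.
move=> psiL sRC wC psiR psiw.
pose Psi v : 'rV[k]_N := \row_i psi i v.
have PsiL : linear Psi.
  by move=> c u v; apply/rowP=> i; rewrite !mxE psiL.
pose PsiLB := GRing.isLinear.Build _ _ _ _ Psi PsiL.
pose Psi' : {linear V -> 'rV[k]_N} := HB.pack Psi PsiLB.
have PsiE v : linfun Psi' v = Psi v by exact: (lfunE Psi' v).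
rewrite -(limg_ker_dim (linfun Psi') C) leq_add //.
  apply: dimvS; rewrite subv_cap sRC /=; apply/subvP=> v vR.
  by rewrite memv_ker PsiE; apply/eqP/rowP=> i; rewrite !mxE psiR.
have -> : (linfun Psi' @: C)%VS = fullv.
  apply/eqP; rewrite eqEsubv subvf /=; apply/subvP=> s _.
  rewrite [s]matrix_sum_delta big_ord1; apply: memv_suml => i _; apply: memvZ.
  apply/memv_imgP; exists (w i) => //; rewrite PsiE; apply/rowP=> l.
  by rewrite !mxE psiw eqxx.
by rewrite dimvf /dim /= mul1n.
Qed.

Section Coradical.
Variables (k : fieldType) (G : finGroupType) (H : hopfAlg k).
Notation kG := (grpalg k G).
Variables (j : {lrmorphism kG -> H}) (x : H) (n : nat) (a : G) (q : k).
Notation jg g := (j (gelt k g)).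
Implicit Types (u v w y b : H) (g h : G).

Hypotheses (basisH : gx_basis j x n) (hopfH : gx_hopf j x a n).
Hypothesis n_gt0 : (0 < n)%N.
Hypothesis xa : x * jg a = q *: (jg a * x).

Notation xc := (xcoef j x n).

Lemma comul_jg g : comul H (jg g) = tens (jg g) (jg g).
Proof.
have := comul_monom hopfH xa g n_gt0.
by rewrite big_ord1 /= !expr0 !mulr1 scale1r expg0 mulg1.
Qed.

(** The terms with 0 < l < m are the only ones besides x^m (x) a^m and
    1 (x) x^m. *)
Lemma comul_pow_skew m : (0 < m < n)%N ->
    (forall l, (0 < l < m)%N -> qbin q m l = 0) ->
  comul H (x ^+ m) = tens (x ^+ m) (jg a ^+ m) + tens 1 (x ^+ m).
Proof.
case: m => // m /andP[_ lt_mn] qb; have := comul_monom hopfH xa 1%g lt_mn.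
have j1 : jg 1%g = 1 by exact: rmorph1.
rewrite j1 mul1r => ->.
rewrite big_ord_recl big_ord_recr big1 ?add0r => [|l _]; last first.
  by rewrite qb ?scale0r //= /bump add1n ltnS ltn_ord.
have lm : lift ord0 (@ord_max m) = m.+1 :> nat by [].
rewrite lm qbinn /= !scale1r subn0 subnn !expr0 mulr1 expg0 !mul1g j1 !mul1r addrC.
by rewrite mulr1 addr0 [RHS]addrC gelt_exp rmorphXn.
Qed.

Lemma counit_jg g : counit H (jg g) = 1.
Proof. by have [_ + _] := hopfH g n_gt0; rewrite expr0 mulr1. Qed.

(** Comparing coefficients of x^r (x) x^r: the square of the r-th coefficient
    of u is a multiple of its 2r-th one.  Descending from the top degree, all
    of them with r > 0 vanish. *)
Lemma xcoef_scaled_grouplike u (c : k) r :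
  u != 0 -> comul H u = c *: tens u u -> (0 < r)%N -> xc r u = 0.
Proof.
move=> u0 uE; have c0 : c != 0.
  apply: contra u0 => /eqP c0; rewrite -(comul_counitl u) uE c0 scale0r.
  by apply/eqP; rewrite /tlift big1 // => i _; rewrite big1 // => l _; rewrite mxE scale0r.
have [m] := ubnP (n - r); elim: m r => // m IH r; rewrite ltnS => le_m r0.
case: (leqP n r) => [|lt_rn]; first exact: xcoef_out.
have u2 : xc (r + r) u = 0.
  case: (leqP n (r + r)) => [|lt_rrn]; first exact: xcoef_out.
  apply: IH; rewrite ?addn_gt0 ?r0 //; apply: leq_trans le_m.
  by rewrite ltn_sub2l // -[X in (X < _)%N]addn0 ltn_add2l.
apply/ffunP=> g; rewrite ffunE; apply/eqP.
have := tcoef_comul basisH hopfH xa r r g g u.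
rewrite u2 uE tcoef_is_linearZ tcoef_tens ffunE mulr0 mul0r => /eqP.
by rewrite mulf_eq0 (negPf c0) mulf_eq0 orbb.
Qed.

(** One-dimensional subcoalgebras are spanned by scaled grouplikes, and these
    lie in kG; conversely each line k g is a simple subcoalgebra. *)
Lemma coradicalE (H0 : {vspace H}) :
  is_coradical H0 -> pointed H -> H0 = limg (linfun j).
Proof.
move=> [subH0 minH0] ptH; apply/eqP; rewrite eqEsubv; apply/andP; split.
  apply: minH0 => C sC; have [C0 coC _] := sC.
  pose u := vpick C.
  have CE : C = <[u]>%VS.
    apply/esym/eqP; rewrite eqEdim -memvE memv_pick (ptH _ sC) dim_vline.
    by rewrite vpick0; case: eqP C0.
  have u0 : u != 0 by rewrite vpick0; apply/eqP.
  have uu : comul H u \in <[tens u u]>%VS.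
    have : comul H u \in tens_vs C C by apply: (subvP coC); apply/memv_img/memv_pick.
    apply/subvP/tens_vs_ind => v w; rewrite CE => /vlineP[c ->] /vlineP[d ->].
    by rewrite tensZl tensZr scalerA memvZ // memv_line.
  have [c uE] := vlineP _ _ uu.
  rewrite CE -memvE; apply/memv_imgP; exists (xc 0 u); first exact: memvf.
  rewrite lfunE /=; apply: (xcoef_inj basisH) => i lt_in.
  rewrite (xcoef_j basisH) //; case: eqP => [->//|/eqP]; rewrite -lt0n.
  exact: xcoef_scaled_grouplike uE.
apply/subvP=> _ /memv_imgP[u _ ->]; rewrite lfunE /= [u]grpalg_sum linear_sum.
apply: memv_suml => g _; rewrite linearZ; apply: memvZ.
have jg0 : jg g != 0.
  apply/eqP=> jg0; have /eqP := counit_jg g; rewrite jg0 linear0 eq_sym; apply/negP.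
  exact: oner_neq0.
apply: (subvP (subH0 <[jg g]>%VS _)); last exact: memv_line.
split.
- by apply/eqP; rewrite -dimv_eq0 dim_vline jg0.
- apply/subvP=> _ /memv_imgP[_ /vlineP[c ->] ->]; rewrite linearZ /= comul_jg.
  by apply/memvZ/mem_tens_vs; exact: memv_line.
move=> D _ sD; case: (eqVneq D 0%VS) => [|D0]; [by left|right].
by apply/eqP; rewrite eqEdim sD dim_vline jg0 lt0n dimv_eq0.
Qed.

Section RankOne.
Let H0 := limg (linfun j).

Lemma mem_H0 (u : kG) : j u \in H0.
Proof. by apply/memv_imgP; exists u; rewrite ?memvf // lfunE. Qed.

Lemma mem_H0P v : v \in H0 -> exists u : kG, v = j u.
Proof. by case/memv_imgP=> u _ ->; exists u; rewrite lfunE. Qed.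

Let T := (tens_vs {:H} H0 + tens_vs H0 {:H})%VS.

Lemma mem_corad1_skew (b : kG) w :
  comul H w = tens w (j b) + tens 1 w -> w \in corad1 H0.
Proof.
move=> wE; rewrite /corad1 -memv_preim wE; apply: memv_add.
  by apply: mem_tens_vs; rewrite ?memvf ?mem_H0.
by apply: mem_tens_vs; rewrite ?memvf // -(rmorph1 j) mem_H0.
Qed.

Lemma corad1_mulj (u : kG) w : w \in corad1 H0 -> j u * w \in corad1 H0.
Proof.
rewrite /corad1 -!memv_preim comulM -/T => wT.
rewrite [u]grpalg_sum linear_sum linear_sum.
have -> : tmul (\sum_g comul H (j ((u g : k) *: gelt k g))) (comul H w) =
    \sum_g (u g : k) *: tmul (comul H (jg g)) (comul H w).
  rewrite -(linear_comb _ _ (tmul_linear_l (comul H w))); congr tmul.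
  by apply: eq_bigr => g _; rewrite !linearZ.
apply: memv_suml => g _; apply: memvZ; rewrite comul_jg.
have sT (X Y : {vspace H}) : (forall v, v \in X -> jg g * v \in X) ->
    (forall v, v \in Y -> jg g * v \in Y) ->
    (tens_vs X Y <= linfun (tmul (tens (jg g) (jg g))) @^-1: tens_vs X Y)%VS.
  move=> hX hY; apply: tens_vs_ind => v1 v2 v1X v2Y.
  by rewrite -memv_preim lfunE /= tmul_tens mem_tens_vs ?hX ?hY.
have h0 v : v \in H0 -> jg g * v \in H0.
  by move=> /mem_H0P[u' ->]; rewrite -rmorphM mem_H0.
have : comul H w \in (linfun (tmul (tens (jg g) (jg g))) @^-1: T)%VS.
  apply: (subvP _ _ wT); rewrite subv_add.
  by rewrite !(subv_trans (sT _ _ _ _)) //; try (by move=> *; exact: memvf);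
     apply: lpreimS; rewrite ?addvSl ?addvSr.
by rewrite -memv_preim lfunE.
Qed.

(** The augmentation of the i-th coefficient: a functional that factors
    through the trivial module tensored over kG with H. *)
Definition xaug i v : k := \sum_g xc i v g.

Lemma xaug_is_linear i : linear (xaug i : H -> k^o).
Proof.
move=> c u v; rewrite /xaug scaler_sumr -big_split; apply: eq_bigr => g _ /=.
by rewrite linearP !ffunE.
Qed.

Lemma xaug_rel i v : v \in trivial_tensor_rel H0 -> xaug i v = 0.
Proof.
pose X : {linear H -> k^o} := HB.pack (xaug i : H -> k^o)
  (GRing.isLinear.Build _ _ _ _ (xaug i : H -> k^o) (xaug_is_linear i)).
have XE w : linfun X w = xaug i w by exact: (lfunE X w).
suff /subvP h : (trivial_tensor_rel H0 <= lker (linfun X))%VS.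
  by move=> /h; rewrite memv_ker XE => /eqP.
apply/span_subvP => _ /allpairsP[[h m] /= [hH0 _ ->]].
have [u ->] := mem_H0P (vbasis_mem hH0).
rewrite memv_ker XE -[xaug i _]/(X _) linearB linearZ /= /xaug.
have -> : counit H (j u) = \sum_g u g.
  rewrite {1}[u]grpalg_sum !linear_sum; apply: eq_bigr => g _.
  by rewrite !linearZ /= counit_jg; exact: mulr1.
rewrite subr_eq0; apply/eqP.
under [RHS]eq_bigr => g _ do rewrite xcoef_jl // grpalg_mulE.
rewrite exchange_big /= [LHS]mulr_suml; apply: eq_bigr => g _.
rewrite -mulr_sumr; congr (_ * _).
by rewrite [RHS](reindex_inj (mulgI g)); apply: eq_bigr => l _; rewrite mulKg.
Qed.

Lemma rel_sub_corad1 : (trivial_tensor_rel H0 <= corad1 H0)%VS.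
Proof.
apply/span_subvP => _ /allpairsP[[h m] /= [hH0 mH1 ->]].
have [u ->] := mem_H0P (vbasis_mem hH0).
by apply: rpredB; [apply: memvZ|apply: corad1_mulj]; exact: vbasis_mem.
Qed.

(** Otherwise 1, x and x^m would all lie in H_1, and the functionals xaug 0,
    xaug 1 and xaug m show that they stay independent in the trivial module
    tensored with H_1, whose dimension would be at least three. *)
Lemma rank_one_skew m : rank_one H0 -> (1 < m < n)%N ->
  comul H (x ^+ m) <> tens (x ^+ m) (jg a ^+ m) + tens 1 (x ^+ m).
Proof.
move=> rk1 /andP[m1 mn] xm.
pose d (i : 'I_3) := nth 0%N [:: 0; 1; m]%N i.
have d_inj : injective d.
  move=> i l /eqP dil; apply/val_inj/eqP.
  rewrite -(@nth_uniq _ 0%N [:: 0; 1; m]%N) ?ltn_ord //=.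
  by rewrite !inE negb_or /= !neq_ltn m1 (ltnW m1).
have dn i : (d i < n)%N.
  by case: i => [[|[|[|//]]] h]; rewrite /d //= (leq_trans _ mn) // ltnW.
suff : (\dim (trivial_tensor_rel H0) + 3 <= \dim (corad1 H0))%N.
  by rewrite rk1 addnC leq_add2r.
apply: (dimv_dual_family (w := fun i => x ^+ d i)
  (psi := fun i => xaug (d i) : H -> k^o)).
- by move=> i; exact: xaug_is_linear.
- exact: rel_sub_corad1.
- case=> [[|[|[|//]]] h]; rewrite /d /=.
  + rewrite expr0 /corad1 -memv_preim comul1 (subvP (addvSl _ _)) //.
    by rewrite mem_tens_vs ?memvf // -(rmorph1 j) mem_H0.
  + apply: (@mem_corad1_skew (gelt k a ^+ 1)); rewrite rmorphXn.
    by apply: comul_pow_skew => [|[|l]] //; rewrite (ltn_trans m1 mn).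
  + by apply: (@mem_corad1_skew (gelt k a ^+ m)); rewrite rmorphXn.
- by move=> i v; exact: xaug_rel.
- move=> i l; rewrite /xaug -[x ^+ _]mul1r -(rmorph1 j) xcoef_monom //.
  rewrite (inj_eq d_inj); case: eqP => _; last by rewrite big1 // => g _; rewrite ffunE.
  rewrite (bigD1 1%g) //= geltE eqxx big1 ?addr0 // => g /negPf g1.
  by rewrite geltE g1.
Qed.
End RankOne.

(** Let y_m be the coefficient of y at x^m, with m > 0 and y_m nonzero.  The
    coefficients of 1 (x) x^m and x^m (x) 1 in Delta y give that y_m is a
    scalar and that b = a^m; those of x^l (x) x^(m-l) give that the binomials
    (m, l) vanish for 0 < l < m.  Thus x^m is skew primitive, so m = 1 by rank
    one, and the constant coefficient is a skew primitive element of kG. *)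
Lemma skew_primitiveE (H0 : {vspace H}) b y :
    is_coradical H0 -> pointed H -> rank_one H0 ->
    grouplike b -> skew_primitive b y -> y \notin H0 ->
  [/\ (1 < n)%N, b = jg a &
      exists c t : k, c != 0 /\ y = c *: x + t *: (jg a - 1)].
Proof.
move=> hH0 hpt; have -> := coradicalE hH0 hpt => rk1 [bb eb] yE yH0.
have b0 : b != 0.
  by apply/eqP=> b0; have /eqP := eb; rewrite b0 linear0 eq_sym; apply/negP/oner_neq0.
have xcb r : (0 < r)%N -> xc r b = 0.
  by apply: (@xcoef_scaled_grouplike b 1) => //; rewrite scale1r.
have bE : b = j (xc 0 b).
  apply: (xcoef_inj basisH) => i _; rewrite (xcoef_j basisH) //.
  by case: eqP => [->//|/eqP]; rewrite -lt0n => /xcb.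
have xc1 r g : xc r (1 : H) g = ((r == 0%N) && (g == 1%g))%:R.
  by rewrite -(rmorph1 j) (xcoef_j basisH) //; case: eqP => _; rewrite ffunE.
have yc r s g h : qbin q (r + s) r * xc (r + s) y g * (h == g * a ^+ r)%g%:R =
    xc r y g * xc s b h + ((r == 0%N) && (g == 1%g))%:R * xc s y h.
  rewrite -(tcoef_comul basisH hopfH xa) yE.
  have -> : tcoef j x n r s g h (tens y b + tens 1 y) =
      tcoef j x n r s g h (tens y b) + tcoef j x n r s g h (tens 1 y).
    by have := @tcoef_is_linear _ _ _ j x n r s g h 1 (tens y b) (tens 1 y); rewrite !scale1r.
  by rewrite !tcoef_tens xc1.
have top m : (0 < m)%N -> xc m y != 0 ->
    [/\ m = 1%N, (1 < n)%N, exists2 c : k, c != 0 & xc m y = c%:A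
      & forall h, xc 0 b h = (h == a ^+ m)%g%:R].
  move=> m0 ym0.
  have lt_mn : (m < n)%N by case: leqP ym0 => // /xcoef_out ->; rewrite eqxx.
  have ymE g : g != 1%g -> xc m y g = 0.
    move=> g1; have := yc 0%N m g g.
    by rewrite add0n qbin0 mulg1 eqxx mulr1 mul1r (negPf g1) mul0r addr0 xcb // ffunE mulr0.
  have ym : xc m y = (xc m y 1%g : k)%:A.
    apply/ffunP=> g; rewrite !ffunE; case: (eqVneq g 1%g) => [->|/ymE ->].
      exact/esym/mulr1.
    exact/esym/mulr0.
  have c0 : (xc m y 1%g : k) != 0.
    by apply: contra ym0 => /eqP c0; rewrite ym c0 scale0r.
  have bm h : xc 0 b h = (h == a ^+ m)%g%:R.
    have := yc m 0%N 1%g h; rewrite addn0 qbinn mul1r mul1g.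
    rewrite gtn_eqF // mul0r addr0 => /(mulfI c0) ->.
    by [].
  have qb l : (0 < l < m)%N -> qbin q m l = 0.
    case/andP=> l0 lm; have := yc l (m - l)%N 1%g (a ^+ l)%g.
    rewrite subnKC ?(ltnW lm) // mul1g eqxx mulr1 gtn_eqF // mul0r addr0.
    rewrite xcb ?subn_gt0 // ffunE mulr0 => /eqP; rewrite mulf_eq0 (negPf c0) orbF.
    by move/eqP.
  case: (ltngtP m 1) => [|m1|m1]; first by rewrite ltnS leqNgt m0.
    case: (@rank_one_skew m rk1); first by rewrite m1.
    by apply: comul_pow_skew; rewrite ?m0.
  by split=> //; [rewrite -m1 | exists (xc m y 1%g)].
have [m m0 ym0] : exists2 m, (0 < m)%N & xc m y != 0.
  apply: NNPP => h; case/negP: yH0; apply/memv_imgP; exists (xc 0 y); first exact: memvf.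
  rewrite lfunE /=; apply: (xcoef_inj basisH) => i _; rewrite (xcoef_j basisH) //.
  case: eqP => [->//|/eqP]; rewrite -lt0n => i0; apply/eqP/negPn/negP=> yi.
  by apply: h; exists i.
have [m1 n1 [c c0 ymE] bm] := top m m0 ym0; subst m.
have xc0b : xc 0 b = gelt k a by apply/ffunP=> h; rewrite bm geltE expg1.
split=> //; first by rewrite bE xc0b.
have y0E g h : xc 0 y g * (h == g)%:R = xc 0 y g * (h == a)%:R + (g == 1%g)%:R * xc 0 y h.
  by have := yc 0%N 0%N g h; rewrite add0n qbin0 mulg1 xc0b (mul1r (xc 0 y g : k)) geltE.
have [t tE] : exists t : k, xc 0 y = t *: (gelt k a - 1).
  case: (eqVneq a 1%g) => [a1|a1].
    exists 0; rewrite scale0r; apply/ffunP=> g; rewrite ffunE.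
    case: (eqVneq g 1%g) => [->|g1].
      have /eqP := y0E 1%g 1%g; rewrite a1 eqxx !mulr1 mul1r -subr_eq0.
      by rewrite opprD addrA subrr add0r oppr_eq0 => /eqP.
    by have := y0E g g; rewrite a1 eqxx (negPf g1) mulr1 mulr0 mul0r addr0.
  exists (xc 0 y a); apply/ffunP=> g; rewrite !ffunE.
  case: (eqVneq g a) => [->|ga].
    by rewrite (negPf a1) subr0; exact/esym/mulr1.
  case: (eqVneq g 1%g) => [->|g1]; last first.
    have := y0E g g; rewrite eqxx (negPf ga) (negPf g1) mulr1 mulr0 mul0r addr0 => ->.
    by rewrite subr0; exact/esym/mulr0.
  have := y0E 1%g a; rewrite !eqxx (negPf a1) mulr0 mulr1 mul1r => /esym/eqP.
  rewrite addr_eq0 => /eqP ->; rewrite sub0r; apply/esym.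
  by transitivity (xc 0 y a * -1) => //; rewrite mulrN1.
exists c, t; split=> //; apply: (xcoef_inj basisH) => i lt_in.
have -> : jg a - 1 = j (gelt k a - 1) by rewrite rmorphB rmorph1.
have xcx : xc i x = if i == 1%N then 1 else 0.
  by rewrite -(xcoef_monom basisH) // rmorph1 mul1r.
rewrite linearD !linearZ /= xcx (xcoef_j basisH) //.
case: i lt_in {xcx} => [|[|i]] lt_in /=; first by rewrite scaler0 add0r.
  by rewrite scaler0 addr0.
rewrite !scaler0 addr0; apply/eqP/negPn/negP=> yi.
by have [] := top i.+2 isT yi.
Qed.
End Coradical.

(** * Reduction to x^n = 0 *)

(** The common form of H_R and H_F in nilpotent type: c is zero for H_R, and
    n is p for H_F. *)
Record nil_presentation (k : fieldType) (p : nat) (G : finGroupType) (A : falgType k)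
    (j : {lrmorphism grpalg k G -> A}) (x : A) (n : nat)
    (chi c : G -> k) (a : G) : Prop := NilPresentation {
  np_chi : linear_character chi;
  np_central : forall g, commute a g;
  np_basis : basis_of {:A} [seq j (gelt k g) * x ^+ i | g <- enum G, i <- iota 0 n];
  np_conj : forall g, j (gelt k g) * x * j (gelt k g^-1%g)
                      = chi g *: x + c g *: (j (gelt k a) - 1);
  np_c : forall g, c g *: (gelt k (a ^+ p)%g - 1) = 0;
  np_x_a : j (gelt k a) * x = chi a *: (x * j (gelt k a));
  np_nil : x ^+ n = 0;
  np_n : (1 < n)%N
}.

Section NilpotentType.
Variables (k : fieldType) (p : nat) (G : finGroupType) (H : hopfAlg k) (H0 : {vspace H}).
Variables (j : {lrmorphism grpalg k G -> H}) (x : H).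
Notation jg g := (j (gelt k g)).

Hypotheses (hp : p \in [pchar k]) (hH0 : is_coradical H0) (hpointed : pointed H).
Hypotheses (hrank : rank_one H0) (hnil : nilpotent_type H0).

Lemma jgV g : jg g * jg g^-1%g = 1.
Proof. by rewrite -rmorphM -geltM mulgV; exact: rmorph1. Qed.

Lemma jVg g : jg g^-1%g * jg g = 1.
Proof. by have := jgV g^-1%g; rewrite invgK. Qed.

Lemma jg_inv g : (jg g)^-1 = jg g^-1%g.
Proof.
have u : jg g \is a GRing.unit.
  by apply/unitrP; exists (jg g^-1%g); rewrite jgV jVg.
by rewrite -[LHS]mulr1 -(jgV g) mulrA mulVr // mul1r.
Qed.

Lemma is_degree_basis n m : (0 < n)%N -> gx_basis j x n -> x ^+ n = 0 ->
  H0 = limg (linfun j) ->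
  is_degree H0 x m -> m = n.
Proof.
move=> n0 bx xn H0E [xm xm_min]; apply/eqP; case: ltngtP => // [mn|nm].
  have sub : (\sum_(i < m) H0 * <[x ^+ i]> <= lker (linfun (xcoef j x n m)))%VS.
    apply/subv_sumP => i _; apply/prodvP => u v; rewrite H0E => /memv_imgP[u' _ ->] /vlineP[c ->].
    rewrite memv_ker !lfunE /= -scalerAr linearZ /= (xcoef_monom bx) ?(ltn_trans _ mn) //.
    by rewrite gtn_eqF // scaler0.
  have := subvP sub _ xm; rewrite memv_ker lfunE /= -[x ^+ m]mul1r -(rmorph1 j).
  by rewrite (xcoef_monom bx) // eqxx oner_eq0.
by have := xm_min _ nm; rewrite xn mem0v.
Qed.

Lemma nilpotent_generator n a q :
    gx_basis j x n -> gx_hopf j x a n -> (0 < n)%N -> q != 0 ->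
    jg a * x = q *: (x * jg a) ->
  [/\ (1 < n)%N, H0 = limg (linfun j) & exists c t s : k, exists m : nat,
    [/\ c != 0, jg a * (c *: x + t *: (jg a - 1)) * jg a^-1%g = s *: (c *: x + t *: (jg a - 1)),
        is_degree H0 (c *: x + t *: (jg a - 1)) m & (c *: x + t *: (jg a - 1)) ^+ m = 0]].
Proof.
move=> bx hx n0 q0 ax; have xa : x * jg a = q^-1 *: (jg a * x).
  by rewrite ax scalerA mulVf // scale1r.
have [b [y [s [m [[gb sy yH0 bys] [dy ym]]]]]] := hnil.
have [n1 bE [c [t [c0 yE]]]] := skew_primitiveE bx hx n0 xa hH0 hpointed hrank gb sy yH0.
split=> //; first exact: coradicalE bx hx n0 xa _ hH0 hpointed.
by exists c, t, s, m; rewrite -yE -jg_inv -bE.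
Qed.

(** Comparing coefficients of x in a y a^-1 = s y gives s = chi(a), and
    chi(a) <> 1 then kills the constant term t (a - 1) of y.  So y is a
    multiple of x, and its degree cannot exceed n since the powers
    1, ..., x^(n-1) already span H over kG. *)
Lemma HR_nil (R : datumR k p G) : is_HR j x R -> H0 = limg (linfun j) /\
  nil_presentation p j x (R_n R) (R_chi R) (fun=> 0) (R_a R).
Proof.
case=> bx cx xn hx; set n := R_n R in bx xn hx *; set a := R_a R in hx *.
have chiL := R_chi_lin R.
have q0 : R_chi R a != 0 := lin_char_neq0 chiL a.
have n0 : (0 < n)%N.
  by rewrite muln_gt0 expn_gt0 (prime_gt0 (pcharf_prime hp)) (prim_order_gt0 (R_N_order R)).
have ax : jg a * x = R_chi R a *: (x * jg a).
  by rewrite scalerAl -cx -(mulrA (jg a * x)) jVg mulr1.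
have [n1 H0E [c [t [s [m [c0 yE dy ym]]]]]] := nilpotent_generator bx hx n0 q0 ax.
split=> //; split=> //.
- by move=> g; have /centerP[_] := R_a_central R; apply; rewrite inE.
- by move=> g; rewrite cx scale0r addr0.
- by move=> g; rewrite scale0r.
move: yE; rewrite mulrDr mulrDl -!scalerAr -!scalerAl cx.
have -> : jg a * (jg a - 1) * jg a^-1%g = jg a - 1.
  by rewrite -mulrA mulrBl jgV mul1r mulrBr mulr1 jgV.
move=> yE.
have [w jaE] : exists w, jg a - 1 = j w.
  by exists (gelt k a - 1); rewrite rmorphB rmorph1.
have sq : s = R_chi R a.
  have xc1x : xcoef j x n 1 x = 1.
    by have := xcoef_monom bx 1 1 n1; rewrite rmorph1 mul1r.
  have := congr1 (xcoef j x n 1) yE; rewrite jaE.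
  rewrite !(linearD, linearZ) /= xc1x !(xcoef_j bx) // !scaler0 !addr0 !scalerA => /eqP.
  rewrite -subr_eq0 -scalerBl => /eqP/ffunP/(_ 1%g); rewrite !ffunE eqxx.
  move/eqP; rewrite [_ *: _]mulr1 subr_eq0 mulrC => /eqP/(mulIf c0) ->.
  by [].
have t0 : t *: (jg a - 1) = 0.
  have cq : c *: (R_chi R a *: x) = R_chi R a *: (c *: x) by rewrite !scalerA mulrC.
  move: yE; rewrite jaE sq scalerDr cq => yE'; move/eqP: (addrI _ yE') => {yE'}.
  rewrite -subr_eq0 -[X in X - _]scale1r -scalerBl scaler_eq0 subr_eq0 eq_sym.
  by rewrite (negPf (R_chi_a R)) => /eqP.
move: dy ym; rewrite t0 addr0 => -[_ dy] ym.
have xm : x ^+ m = 0.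
  by move/eqP: ym; rewrite exprZn scaler_eq0 expf_eq0 (negPf c0) andbF => /eqP.
case: (leqP m n) => [mn|nm]; first by rewrite -(subnKC mn) exprD xm mul0r.
case/negP: (dy _ nm); rewrite (xcoefE bx ((c *: x) ^+ n)) H0E.
apply: memv_sumr => i _.
have -> : x ^+ i = c ^- i *: (c *: x) ^+ i.
  by rewrite exprZn scalerA mulVf ?scale1r // expf_neq0.
rewrite -scalerAr; apply/memvZ/memv_mul; last exact: memv_line.
exact: mem_H0.
Qed.

(** If alpha_0 = 1, then y^p = c^p x + (an element of kG) in characteristic p.
    This is nonzero, and it lies in the span of 1 and y over kG; the degree of
    y is therefore at most p, which contradicts the vanishing of the
    corresponding power of y.  Hence alpha_0 = 0, and alpha_(-1) = 0 with it. *)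
Lemma HF_nil (F : datumF k p G) : is_HF j x F -> H0 = limg (linfun j) /\
  nil_presentation p j x p (F_chi F) (F_c F) (F_a F).
Proof.
case=> bx cx xp hx; set a := F_a F in cx xp hx *.
have chiL := F_chi_lin F; have p1 := prime_gt1 (pcharf_prime hp).
have p0 : (0 < p)%N by exact: ltnW.
have ax : jg a * x = F_chi F a *: (x * jg a).
  have := cx a; rewrite {3}/a F_c_a scale0r addr0 => cxa.
  by rewrite scalerAl -cxa -(mulrA (jg a * x)) jVg mulr1.
have q0 : F_chi F a != 0 := lin_char_neq0 chiL a.
have [n1 H0E [c [t [s [m [c0 yE dy ym]]]]]] := nilpotent_generator bx hx p0 q0 ax.
have {}ax : jg a * x = x * jg a by rewrite ax /a F_chi_a scale1r.
case: (F_a0_01 F) => F0; last first.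
  pose y := c *: x + t *: (jg a - 1).
  have pH : p \in [pchar H] by rewrite pchar_lalg.
  have pFD u v : u * v = v * u -> (u + v) ^+ p = u ^+ p + v ^+ p :> H.
    by move=> uv; have := pFrobenius_autD_comm pH uv; rewrite !pFrobenius_autE.
  have pFZ (d : k) u : (d *: u) ^+ p = d ^+ p *: u ^+ p :> H by rewrite exprZn.
  have jE1 g : exists w, jg g - 1 = j w.
    by exists (gelt k g - 1); rewrite rmorphB rmorph1.
  have [[w jaE] [wp jpE]] := (jE1 a, jE1 (a ^+ p)%g).
  have [h hH0' ypE] : exists2 h, h \in limg (linfun j) & y ^+ p = c ^+ p *: x + h.
    exists (c ^+ p *: (F_am1 F *: j wp) + t ^+ p *: j (w ^+ p)).
      by rewrite memvD ?memvZ ?mem_H0.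
    rewrite /y pFD; last first.
      rewrite -!(scalerAl, scalerAr) mulrBl mulrBr ax mul1r mulr1.
      by rewrite scalerA mulrC -scalerA.
    rewrite !pFZ xp F0 scale1r jaE jpE -rmorphXn scalerDr.
    by rewrite [RHS]addrCA [RHS]addrA.
  case: (leqP m p) => [mp|pm].
    have : y ^+ p = 0 by rewrite -(subnKC mp) exprD ym mul0r.
    have xc1x : xcoef j x p 1 x = 1.
      by have := xcoef_monom bx 1 1 n1; rewrite rmorph1 mul1r.
    have [v hv] := mem_H0P hH0'.
    rewrite ypE hv => /(congr1 (xcoef j x p 1)).
    rewrite linearD linearZ linear0 /= xc1x (xcoef_j bx) // addr0 => /ffunP/(_ 1%g).
    rewrite !ffunE eqxx => /eqP; rewrite [_ *: _]mulr1 expf_eq0 (negPf c0) andbF.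
    by [].
  case/negP: (dy.2 _ pm); rewrite -/y ypE.
  have xE : c ^+ p *: x = c ^+ p.-1 *: y - c ^+ p.-1 *: (t *: j w).
    by rewrite /y jaE scalerDr addrK scalerA -exprSr prednK.
  rewrite xE -addrA H0E (bigD1 (Ordinal p0)) //= (bigD1 (Ordinal p1)) //=.
  rewrite addrC expr0 expr1; apply: memv_add.
    rewrite -[X in X \in _]mulr1; apply: memv_mul; last exact: memv_line.
    by rewrite memvD // memvN !memvZ ?mem_H0.
  rewrite -[X in X \in _]addr0; apply: memv_add; last exact: mem0v.
  rewrite (_ : _ *: y = (c ^+ p.-1)%:A * y); last by rewrite -scalerAl mul1r.
  apply: memv_mul; last exact: memv_line.
  by rewrite memvZ // -(rmorph1 j) mem_H0.
split=> //; split=> //.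
- by move=> g; have /centerP[_] := F_a_central F; apply; rewrite inE.
- exact: F_cond0.
- by rewrite ax F_chi_a scale1r.
by rewrite xp F0 scale0r addr0 F_am1_triv // scale0r.
Qed.
End NilpotentType.

(** * Simple modules *)

Section ModuleIsomorphisms.
Variables (A : nzRingType).

Lemma iso_mod_sym (M N : lmodType A) : iso_mod M N -> iso_mod N M.
Proof.
case=> f [g fK gK]; have gL : linear g.
  by move=> a u v; apply: (can_inj fK); rewrite linearP !gK.
pose g' : {linear N -> M} := HB.pack g (GRing.isLinear.Build _ _ _ _ g gL).
by exists g', f.
Qed.

Lemma iso_simple_mod (M N : lmodType A) : iso_mod M N -> simple_mod M -> simple_mod N.
Proof.
case=> f [g fK gK] [[m m0] sM]; split.
  exists (f m) => fm; apply: m0; apply: (can_inj fK); by rewrite fm linear0.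
move=> U [U0 UM]; have [|h|h] := sM (fun m => U (f m)).
- by split=> [|a u v]; rewrite ?linear0 // linearP; exact: UM.
- by left=> y Uy; rewrite -[y]gK (h (g y)) ?linear0 ?gK.
- by right=> y; rewrite -[y]gK.
Qed.
End ModuleIsomorphisms.

Lemma iso_has_character (k : fieldType) (G : finGroupType)
    (M N : lmodType (grpalg k G)) lam :
  iso_mod M N -> has_character N lam -> has_character M lam.
Proof.
move=> /iso_mod_sym[f [f' fK f'K]] [d [b [r [b_bij rb lamE]]]].
exists d, (fun i => f (b i)), r; split=> // [|g l].
  apply: (eq_bij (bij_comp (Bijective fK f'K) b_bij)) => s /=.
  by rewrite linear_sum; apply: eq_bigr => i _; rewrite linearZ.
by rewrite -linearZ rb linear_sum; apply: eq_bigr => i _; exact: linearZ.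
Qed.

Lemma nilpotent_kernel (A : nzRingType) (M : lmodType A) (z : A) N (m : M) :
  z ^+ N = 0 -> m <> 0 -> exists2 m' : M, m' <> 0 & z *: m' = 0.
Proof.
elim: N m => [|N IH] m zN m0.
  by case: m0; rewrite -[m]scale1r -(expr0 z) zN scale0r.
case: (eqVneq (z ^+ N *: m) 0) => [zNm|/eqP zNm].
  have [] := classic (exists2 m' : M, m' <> 0 & z *: m' = 0) => // h.
  have zi i : z ^+ i *: m <> 0.
    elim: i => [|i IHi]; first by rewrite expr0 scale1r.
    by rewrite exprS -scalerA => zi; apply: h; exists (z ^+ i *: m).
  by case: (zi N).
by exists (z ^+ N *: m); rewrite ?scalerA -?exprS ?zN ?scale0r.
Qed.

Lemma central_nilpotent_simple (A : nzRingType) (M : lmodType A) (z : A) N :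
  (forall h, h * z = z * h) -> z ^+ N = 0 -> simple_mod M -> forall m : M, z *: m = 0.
Proof.
move=> zc zN [[m0 m0N0] /(_ (fun m => z *: m = 0))[|h|//]].
  split=> [|h u v zu zv]; first by rewrite scaler0.
  by rewrite scalerDr scalerA -zc -scalerA zu zv scaler0 addr0.
by have [m' m'0 zm'] := nilpotent_kernel zN m0N0; case: m'0; apply: h.
Qed.

(** A copy of V that keeps only its additive structure, free to receive
    another module structure. *)
Definition inflate (V : Type) : Type := V.
HB.instance Definition _ (V : zmodType) := GRing.Zmodule.on (inflate V).

Section SimpleModules.
Variables (k : fieldType) (p : nat) (G : finGroupType) (A : falgType k).
Notation kG := (grpalg k G).
Variables (j : {lrmorphism kG -> A}) (x : A) (n : nat) (chi c : G -> k) (a : G).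
Notation jg g := (j (gelt k g)).
Notation xc := (xcoef j x n).
Hypothesis (hp : p \in [pchar k]).
Hypothesis hP : nil_presentation p j x n chi c a.

Let bx := np_basis hP.
Let n0 : (0 < n)%N := ltnW (np_n hP).
Local Notation z := (gelt k a - 1 : kG).

Lemma x_jg g : x * jg g = jg g * (chi g^-1%g *: x + c g^-1%g *: j z).
Proof.
rewrite rmorphB rmorph1 -(np_conj hP) invgK !mulrA -rmorphM -geltM mulgV.
by rewrite -[LHS]mul1r mulrA; congr (_ * _ * _); exact/esym/rmorph1.
Qed.

Lemma act_killed (M : lmodType A) (m : M) h :
  x *: m = 0 -> h *: m = j (xc 0 h) *: m.
Proof.
move=> xm; rewrite {1}(xcoefE bx h) scaler_suml (bigD1 (Ordinal n0)) //= expr0 mulr1.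
rewrite big1 ?addr0 // => -[[|i] lt_in] //= _.
by rewrite -scalerA exprSr -scalerA xm !scaler0.
Qed.

Lemma restr_scaleE (M : lmodType A) (u : kG) (m : M) :
  u *: (m : restr j M) = (j u *: m : M).
Proof. by []. Qed.

Lemma conj_defect_order g : c g != 0 -> (a ^+ p)%g = 1%g.
Proof.
move=> cg0; have /eqP := np_c hP g; rewrite scaler_eq0 (negPf cg0) subr_eq0 => /eqP ap.
apply/eqP/negPn/negP=> /negPf ap1; have /eqP := oner_neq0 k; apply.
by have /ffunP/(_ (a ^+ p)%g) := ap; rewrite -gelt1 !geltE eqxx ap1.
Qed.

Lemma defect_nilpotent : (a ^+ p)%g = 1%g -> z ^+ p = 0.
Proof.
move=> ap; have pG : p \in [pchar kG] by rewrite pchar_lalg.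
have cz : GRing.comm (gelt k a) (- 1 : kG) by rewrite /GRing.comm mulrN1 mulN1r.
have := pFrobenius_autD_comm pG cz; rewrite !pFrobenius_autE => ->.
rewrite -gelt_exp ap gelt1.
by have := pFrobenius_autN pG 1; rewrite !pFrobenius_autE expr1n => ->; rewrite subrr.
Qed.

Lemma defect_central (u : kG) : u * z = z * u.
Proof.
rewrite mulrBr mulrBl mulr1 mul1r; congr (_ - _).
rewrite [u]grpalg_sum mulr_sumr mulr_suml; apply: eq_bigr => g' _.
by rewrite -scalerAl -scalerAr -!geltM (np_central hP).
Qed.

(** It remains to commute with x; and a commutes with x because chi(a), a p-th
    root of unity in characteristic p, is 1. *)
Lemma j_defect_central h : (a ^+ p)%g = 1%g -> h * j z = j z * h.
Proof.
move=> ap; have chia : chi a = 1.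
  have cp : chi a ^+ p = 1.
    rewrite -(np_chi hP).1 -ap; elim: (p) => [|i IH].
      by rewrite expr0 expg0 (np_chi hP).1.
    by rewrite exprS expgS (np_chi hP).2 IH.
  have := pFrobenius_autB_comm hp (mulrC (chi a) 1); rewrite !pFrobenius_autE expr1n cp subrr.
  by move/eqP; rewrite expf_eq0 subr_eq0 => /andP[_ /eqP].
have xz : x * j z = j z * x.
  by rewrite rmorphB rmorph1 mulrBr mulrBl mulr1 mul1r (np_x_a hP) chia scale1r.
have xiz i : x ^+ i * j z = j z * x ^+ i.
  by elim: i => [|i IH]; rewrite ?expr0 ?mulr1 ?mul1r // exprS -mulrA IH mulrA xz mulrA.
rewrite (xcoefE bx h) mulr_suml mulr_sumr; apply: eq_bigr => i _.
by rewrite -mulrA xiz mulrA -rmorphM defect_central rmorphM mulrA.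
Qed.

Lemma simple_killed_by_defect (M : lmodType A) : simple_mod M ->
  forall g (m : M), (c g *: j z) *: m = 0.
Proof.
move=> sM g m; case: (eqVneq (c g) 0) => [->|/conj_defect_order ap]; first by rewrite !scale0r.
have zp : j z ^+ p = 0 by rewrite -rmorphXn defect_nilpotent ?rmorph0.
rewrite -mulr_algl -scalerA (central_nilpotent_simple _ zp) ?scaler0 // => h.
exact: j_defect_central.
Qed.

Lemma simple_grpalg_killed_by_defect (V : lmodType kG) : simple_mod V ->
  forall g (v : V), (c g *: z) *: v = 0.
Proof.
move=> sV g v; case: (eqVneq (c g) 0) => [->|/conj_defect_order ap]; first by rewrite !scale0r.
rewrite -mulr_algl -scalerA (central_nilpotent_simple defect_central (defect_nilpotent ap)) //.
exact: scaler0.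
Qed.

Lemma killed_by_x_stable (M : lmodType A) (m : M) (u : kG) :
    (forall g (m : M), (c g *: j z) *: m = 0) -> x *: m = 0 ->
  x *: (j u *: m) = 0.
Proof.
move=> zM xm; have xjm g : (x * jg g) *: m = 0.
  rewrite x_jg -scalerA scalerDl zM addr0 -[chi _ *: x]mulr_algl.
  by rewrite -[_ *: m]scalerA xm !scaler0.
rewrite scalerA {1}[u]grpalg_sum linear_sum mulr_sumr scaler_suml.
apply: big1 => g _; rewrite linearZ /= -scalerAr.
by rewrite -mulr_algl -scalerA xjm scaler0.
Qed.

(** Once the defects c(g) (a - 1) act as zero, x commutes with the elements of
    G up to scalars, so that the kernel of x is a submodule. *)
Lemma simple_killed_by_x (M : lmodType A) : simple_mod M -> forall m : M, x *: m = 0.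
Proof.
move=> sM; have zM := simple_killed_by_defect sM.
have [[m0 m0N0] /(_ (fun m => x *: m = 0))[|h|//]] := sM.
  split=> [|h u v xu xv]; first by rewrite scaler0.
  by rewrite scalerDr xv addr0 (act_killed h xu) killed_by_x_stable.
by have [m' m'0 zm'] := nilpotent_kernel (np_nil hP) m0N0; case: m'0; apply: h.
Qed.

Lemma simple_restr (M : lmodType A) :
  simple_mod M <-> (simple_mod (restr j M) /\ forall m : M, x *: m = 0).
Proof.
split=> [sM|[[M0 sM] xM]].
  have xM := simple_killed_by_x sM; split=> //; have [M0 sM'] := sM; split=> // U [U0 UM].
  by apply: sM'; split=> // h u v Uu Uv; rewrite act_killed //; exact: (UM (xc 0 h)).
split=> // U [U0 UM]; apply: sM; split=> // u m1 m2 U1 U2.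
by rewrite restr_scaleE; exact: UM.
Qed.

(** H acts through the constant coefficient.  This is multiplicative modulo
    the ideal of kG generated by the defects c(g) (a - 1). *)
Lemma inflation (V : lmodType kG) :
    (forall g (v : V), (c g *: z) *: v = 0) ->
  exists M : lmodType A, (forall m : M, x *: m = 0) /\ iso_mod (restr j M) V.
Proof.
move=> zV.
have xc_x h v : xc 0 (x * h) *: v = 0 :> V.
  rewrite {1}(xcoefE bx h) mulr_sumr linear_sum scaler_suml; apply: big1 => i _ /=.
  rewrite mulrA {1}[xc i h]grpalg_sum linear_sum mulr_sumr mulr_suml linear_sum scaler_suml.
  apply: big1 => g _; rewrite linearZ /= -scalerAr -scalerAl linearZ /=.
  rewrite x_jg -mulrA mulrDl xcoef_jl // linearD -!scalerAl !linearZ /= -exprS.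
  have -> : xc 0 (x ^+ i.+1) = 0.
    case: (ltnP i.+1 n) => [lt_in|le_ni]; last first.
      by rewrite -(subnK le_ni) exprD (np_nil hP) mulr0 linear0.
    by rewrite -[x ^+ _]mul1r -(rmorph1 j) xcoef_monom.
  rewrite scaler0 add0r xcoef_monom //; case: eqP => _; last by rewrite !(scaler0, mulr0) scale0r.
  by rewrite -mulr_algl -!scalerA zV !scaler0.
pose act h (v : inflate V) : inflate V := xc 0 h *: (v : V).
have actA h h' v : act h (act h' v) = act (h * h') v.
  rewrite /act [in RHS](xcoefE bx h) mulr_suml linear_sum scaler_suml (bigD1 (Ordinal n0)) //=.
  rewrite expr0 mulr1 xcoef_jl // scalerA big1 ?addr0 // => -[[|i] lt_in] //= _.
  by rewrite -mulrA xcoef_jl // -scalerA exprS -mulrA xc_x scaler0.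
have act1 : left_id 1 act.
  by move=> v; rewrite /act -(rmorph1 j) (xcoef_j bx) //= scale1r.
have actDr : right_distributive act +%R by move=> h u v; rewrite /act scalerDr.
have actDl v : {morph act^~ v : h h' / h + h'}.
  by move=> h h'; rewrite /act linearD scalerDl.
pose M : lmodType A := HB.pack (inflate V)
  (GRing.Zmodule_isLmodule.Build A (inflate V) actA act1 actDr actDl).
have scE h (m : M) : h *: m = act h m by [].
exists M; split=> [m|].
  by rewrite scE /act; have := xc_x 1 m; rewrite mulr1.
pose f (m : restr j M) : V := m.
have fL : linear f.
  move=> u m1 m2; rewrite /f -[u in RHS](_ : xc 0 (j u) = u) //.
  by rewrite (xcoef_j bx).
pose f' : {linear restr j M -> V} := HB.pack f (GRing.isLinear.Build _ _ _ _ f fL).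
by exists f', (fun v : V => v).
Qed.

End SimpleModules.

(** * Projective modules over an arbitrary ring *)

Section FreeCover.
Import freeg.

(** P is a direct summand of the free module on its elements.  If all
    coordinates of p0 were in xA, then p0 would be x times an element. *)
Lemma projective_coordinate (A : nzRingType) (P : lmodType A) (x : A) (p0 : P) :
    projective_mod P -> (forall q, p0 <> x *: q) ->
  exists phi : {linear P -> A^o}, forall c, phi p0 <> x * c.
Proof.
move=> prP p0x; pose F := {freeg P / A}.
pose pi (D : F) : P := fglift (fun v : P => v) D.
pose piA : {additive F -> P} := HB.pack pi
  (GRing.isZmodMorphism.Build _ _ pi (lift_is_additive (fun v : P => v))).
have piU c v : pi << c *g v >> = c *: v by exact: liftU.
have scU c d v : c *: << d *g v >> = << c * d *g v >> :> F.
  by apply/eqP/freeg_eqP=> t; rewrite coeffZ !coeffU mulrA.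
have pi_lin : linear pi.
  move=> c D1 D2; rewrite -[pi]/(piA : F -> P) raddfD /=; congr (_ + _).
  have piD := freeg_sumE D1; set s := dom D1 in piD; rewrite -piD.
  rewrite scaler_sumr.
  have pi_sum (E : P -> F) : pi (\sum_(v <- s) E v) = \sum_(v <- s) pi (E v).
    exact: (raddf_sum piA).
  rewrite !pi_sum scaler_sumr; apply: eq_bigr => t _.
  by rewrite scU !piU scalerA.
pose piL : {linear F -> P} := HB.pack pi (GRing.isLinear.Build _ _ _ _ pi pi_lin).
pose idP : {linear P -> P} := idfun.
have [v|h hK] := prP F P piL idP; first by exists << 1 *g v >>; rewrite /= piU scale1r.
have [t ht] : exists t, forall c, coeff t (h p0) <> x * c.
  apply: NNPP => nt.
  have div (s : seq P) : exists D : F, \sum_(v <- s) << coeff v (h p0) *g v >> = x *: D.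
    elim: s => [|v s [D sE]]; first by exists 0; rewrite big_nil scaler0.
    have [c cE] : exists c, coeff v (h p0) = x * c.
      by apply: NNPP => nc; apply: nt; exists v => c cE; apply: nc; exists c.
    by exists (<< c *g v >> + D); rewrite big_cons sE cE scalerDr scU.
  have [D hE] := div (dom (h p0)); rewrite freeg_sumE in hE.
  by apply: (p0x (pi D)); rewrite -[LHS](hK p0) hE -[pi D]/(piL D) linearZ.
pose phi (v : P) : A^o := coeff t (h v).
have phiL : linear phi by move=> c u v; rewrite /phi linearP coeffD coeffZ.
pose phi' : {linear P -> A^o} := HB.pack phi (GRing.isLinear.Build _ _ _ _ phi phiL).
by exists phi'.
Qed.

End FreeCover.

(** * The submodules of He *)

(** If |G| = 0 in k, the norm element N = sum_g g has square zero.  Its line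
    is a left ideal, and writing 1 = c N + w with w in a complementary left
    ideal gives N = N w in that complement. *)
Lemma semisimple_card_unit (k : fieldType) (G : finGroupType) (H : hopfAlg k)
    (j : {lrmorphism grpalg k G -> H}) :
  injective j -> semisimple_subalg (limg (linfun j)) -> #|G|%:R != 0 :> k.
Proof.
move=> j_inj ss; apply/eqP=> G0; pose N : grpalg k G := \sum_g gelt k g.
have uN u : u * N = (\sum_g (u g : k)) *: N.
  rewrite {1}[u]grpalg_sum mulr_suml scaler_suml; apply: eq_bigr => g _.
  rewrite -scalerAl; congr (_ *: _); rewrite mulr_sumr [RHS](reindex_inj (mulgI g)).
  by apply: eq_bigr => h _; rewrite geltM.
have NN : N * N = 0.
  rewrite uN (_ : \sum_g N g = 0) ?scale0r //.
  rewrite (eq_bigr (fun=> 1)) ?sumr_const // => g _.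
  rewrite sum_ffunE (bigD1 g) //= geltE eqxx big1 ?addr0 // => h /negPf hg.
  by rewrite geltE eq_sym hg.
have N0 : N != 0.
  apply/eqP=> /ffunP/(_ 1%g)/eqP; rewrite sum_ffunE (bigD1 1%g) //= geltE eqxx ffunE.
  rewrite big1 ?addr0 ?oner_eq0 // => h /negPf hg.
  by rewrite geltE eq_sym hg.
have memj u : j u \in limg (linfun j) by exact: mem_H0.
have [||W [sW HW UW UIW]] := ss <[j N]>%VS.
- by rewrite -memvE memj.
- apply/prodvP => _ _ /mem_H0P[u ->] /vlineP[c ->].
  by rewrite -scalerAr -rmorphM uN /= linearZ /= scalerA memvZ // memv_line.
have : (1 : H) \in (<[j N]> + W)%VS by rewrite UW -(rmorph1 j) memj.
case/memv_addP=> _ /vlineP[c ->] [w wW one].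
case/eqP: N0; apply: j_inj; rewrite rmorph0; apply/eqP; rewrite -memv0 -UIW.
rewrite memv_cap memv_line -[j N]mulr1 one mulrDr -scalerAr -rmorphM NN rmorph0 scaler0 add0r.
by apply: (subvP HW); apply: memv_mul.
Qed.

Section SubmodulesOfProjectives.
Variables (k : fieldType) (p : nat) (G : finGroupType) (A : falgType k).
Notation kG := (grpalg k G).
Variables (j : {lrmorphism kG -> A}) (x : A) (n : nat) (chi c : G -> k) (a : G).
Notation jg g := (j (gelt k g)).
Notation xc := (xcoef j x n).
Hypothesis (hp : p \in [pchar k]).
Hypothesis hP : nil_presentation p j x n chi c a.
Hypothesis G_unit : #|G|%:R != 0 :> k.
Implicit Types (u v : kG) (h : A).

Let bx := np_basis hP.
Let n0 : (0 < n)%N := ltnW (np_n hP).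
Let chiL := np_chi hP.

(** If c(g) is nonzero then a^p = 1; as p does not divide |G|, a = 1. *)
Lemma conj_defect0 g : c g *: (gelt k a - 1 : kG) = 0.
Proof.
case: (eqVneq (c g) 0) => [->|/(conj_defect_order hP) ap]; first by rewrite scale0r.
suff -> : a = 1%g by rewrite gelt1 subrr scaler0.
have cop : coprime p #|G|.
  rewrite prime_coprime ?(pcharf_prime hp) //.
  by rewrite (dvdn_pcharf hp).
have /eqP : a = 1%g.
  apply/eqP; rewrite -order_eq1 -dvdn1 -(eqP cop) dvdn_gcd.
  by rewrite order_dvdn ap eqxx -cardsT order_dvdG ?inE.
by move/eqP.
Qed.

Lemma conj_semisimple g : jg g * x = chi g *: (x * jg g).
Proof.
have j1 : jg g^-1%g * jg g = 1.
  by rewrite -rmorphM -geltM mulVg; exact: rmorph1.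
have := np_conj hP g.
have -> : c g *: (jg a - 1) = 0.
  by rewrite -(rmorph1 j) -rmorphB -linearZ /= conj_defect0 rmorph0.
rewrite addr0 => /(congr1 (fun h => h * jg g)).
by rewrite -mulrA j1 mulr1 -scalerAl.
Qed.

Lemma x_j u : x * j u = j (shift chi 1 u) * x.
Proof.
rewrite [u]grpalg_sum /shift gtwist_sum !linear_sum mulr_sumr mulr_suml.
apply: eq_bigr => g _; rewrite gtwistZ gtwist_gelt !linearZ /= -scalerAr -!scalerAl.
rewrite conj_semisimple; congr (_ *: _).
by rewrite scalerA expr1 mulVf ?scale1r // lin_char_neq0.
Qed.

Lemma xpow_j i u : x ^+ i * j u = j (shift chi i u) * x ^+ i.
Proof.
elim: i u => [|i IH] u; first by rewrite expr0 mul1r mulr1 shift0.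
by rewrite exprS -mulrA IH mulrA x_j -shiftS mulrA.
Qed.

Lemma j_xpow i u : j u * x ^+ i = x ^+ i * j (unshift chi i u).
Proof. by rewrite xpow_j unshiftK. Qed.

Lemma xpow_normal i h : exists h', h * x ^+ i = x ^+ i * h'.
Proof.
exists (\sum_(s < n) j (unshift chi i (xc s h)) * x ^+ s).
rewrite {1}(xcoefE bx h) mulr_suml mulr_sumr; apply: eq_bigr => s _.
by rewrite -mulrA -exprD addnC exprD mulrA j_xpow mulrA.
Qed.

Lemma xcoef_xpow i l h : (l < n)%N ->
  xc l (x ^+ i * h) = if (i <= l)%N then shift chi i (xc (l - i) h) else 0.
Proof.
move=> lt_ln; have hE : x ^+ i * h = \sum_(s < n) j (shift chi i (xc s h)) * x ^+ (i + s).
  rewrite {1}(xcoefE bx h) mulr_sumr; apply: eq_bigr => s _.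
  by rewrite mulrA xpow_j -mulrA -exprD.
have term (s : nat) : xc l (j (shift chi i (xc s h)) * x ^+ (i + s)) =
    if l == (i + s)%N then shift chi i (xc s h) else 0.
  case: (ltnP (i + s) n) => [lt_isn|le_nis]; first by rewrite (xcoef_monom bx).
  rewrite -(subnK le_nis) exprD (np_nil hP) !mulr0 linear0.
  by rewrite subnK // ltn_eqF // (leq_trans lt_ln).
rewrite hE linear_sum /=; under eq_bigr => s _ do rewrite term.
case: leqP => [le_il|lt_li]; last first.
  by rewrite big1 // => s _; rewrite ltn_eqF // ltn_addr.
have lt_lin : (l - i < n)%N by apply: leq_ltn_trans lt_ln; exact: leq_subr.
rewrite (bigD1 (Ordinal lt_lin)) //= subnKC // eqxx big1 ?addr0 // => s.
by rewrite -val_eqE /= => sn; case: eqP => // lE; rewrite lE addKn eqxx in sn.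
Qed.

Lemma xcoef0_j : cancel j (xc 0).
Proof. by move=> u; rewrite (xcoef_j bx). Qed.

Lemma x_decomp h : exists h', h = j (xc 0 h) + x * h'.
Proof.
exists (\sum_(s < n.-1) j (unshift chi 1 (xc s.+1 h)) * x ^+ s).
rewrite {1}(xcoefE bx h); case: (n) n0 => // n' _; rewrite big_ord_recl expr0 mulr1.
congr (_ + _); rewrite mulr_sumr; apply: eq_bigr => s _.
by rewrite /= /bump /= add1n exprS mulrA -[in LHS](expr1 x) j_xpow expr1 mulrA.
Qed.

Section Projective.
Variable e : kG.
Hypothesis pe : primitive_idem e.
Let ee : e * e = e. Proof. by case: pe. Qed.
Let jee : j e * j e = j e. Proof. by rewrite -rmorphM ee. Qed.
Let M := lideal (j e).
Let gen u : M := lideal_gen (j e) (j u).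
Implicit Types (m : M) (U W : M -> Prop).

Definition xlayer (i : nat) (m : M) := exists m', m = x ^+ i *: m' :> M.

Lemma xlayer_submodule i : submodule (xlayer i).
Proof.
split=> [|h _ _ [m ->] [m' ->]]; first by exists 0; rewrite scaler0.
have [h' hE] := xpow_normal i h.
by exists (h' *: m + m'); rewrite scalerDr !scalerA hE.
Qed.

Lemma xlayerS i m : xlayer i.+1 m -> xlayer i m.
Proof. by case=> m' ->; exists (x *: m'); rewrite scalerA exprSr. Qed.

Lemma xlayer_le i l m : (i <= l)%N -> xlayer l m -> xlayer i m.
Proof.
by move=> /subnK <-; elim: (l - i)%N => // d IH /xlayerS.
Qed.

Lemma xlayer_n m : xlayer n m -> m = 0.
Proof. by case=> m' ->; rewrite (np_nil hP) scale0r. Qed.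

Lemma gen_e u : gen (u * e) = gen u.
Proof. by apply: lideal_val_inj; rewrite !lideal_genE rmorphM -mulrA jee. Qed.

Lemma genZ u v : gen (u * v) = j u *: gen v.
Proof. by apply: lideal_val_inj; rewrite lideal_valZ !lideal_genE rmorphM mulrA. Qed.

Lemma gen_decomp m : exists u m', u * e = u /\ m = gen u + x *: m'.
Proof.
have [h hE] := x_decomp (lideal_val m).
exists (xc 0 (lideal_val m) * e), (h *: gen 1); split; first by rewrite -mulrA ee.
apply: lideal_val_inj; rewrite gen_e lideal_valD !lideal_valZ !lideal_genE rmorph1 mul1r.
by rewrite mulrA -mulrDl -hE lideal_valK.
Qed.

(** Modulo x^(i+1) He, the elements of U are x^i v with v in a left ideal
    contained in kGe, which is 0 or kGe. *)
Lemma layer_dichotomy U i : submodule U -> (forall m, U m -> xlayer i m) ->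
  (forall m, U m -> xlayer i.+1 m) \/
  (forall m, xlayer i m -> exists u m' : M, U u /\ m = u + x ^+ i.+1 *: m').
Proof.
move=> [U0 UM] sU.
have [|| h0 | [_ [u [m' [Uu genE]]]]] := @primitive_left_ideal _ _ G_unit e
  (fun v => v * e = v /\ exists u m' : M, U u /\ x ^+ i *: gen v = u + x ^+ i.+1 *: m') pe.
- split.
    rewrite mul0r; split=> //; exists 0, 0; split=> //.
    by rewrite -(mul0r 0) genZ rmorph0 !scale0r !scaler0 addr0.
  move=> b v w [ve [u1 [m1 [U1 E1]]]] [we [u2 [m2 [U2 E2]]]].
  split; first by rewrite mulrDl -mulrA ve we.
  have [h hE] := xpow_normal i.+1 (j (shift chi i b)).
  exists (j (shift chi i b) *: u1 + u2), (h *: m1 + m2); split; first exact: UM.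
  have -> : gen (b * v + w) = j b *: gen v + gen w.
    by rewrite -genZ; apply: lideal_val_inj; rewrite lideal_valD !lideal_genE rmorphD mulrDl.
  rewrite scalerDr E2 scalerA xpow_j -scalerA E1 !scalerDr !scalerA hE.
  by rewrite addrACA.
- by move=> v [].
- left=> m Um; have [m' mE] := sU m Um; have [u [m1 [ue m'E]]] := gen_decomp m'.
  have u0 : u = 0.
    apply: h0; split=> //; exists m, (- m1); split=> //.
    by rewrite mE m'E scalerDr exprSr -scalerA scalerN scalerN addrK.
  exists m1; rewrite mE m'E u0 -(mul0r 0) genZ rmorph0 scale0r add0r scalerA exprSr.
  by [].
right=> _ [m0 ->]; have [v [m1 [ve ->]]] := gen_decomp m0.
have [h hE] := xpow_normal i.+1 (j (shift chi i v)).
exists (j (shift chi i v) *: u), (h *: m' + m1); split.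
  by rewrite -[_ *: u]addr0; exact: UM.
have -> : gen v = j v *: gen e by rewrite -genZ ve.
rewrite scalerDr scalerA xpow_j -scalerA genE !scalerDr !scalerA hE.
by rewrite -addrA -exprSr.
Qed.

(** Multiplying the covering hypothesis by powers of x gives it for all
    l >= i, and descending induction on l starts from x^n He = 0. *)
Lemma layer_sub U i : submodule U ->
    (forall m, xlayer i m -> exists u m' : M, U u /\ m = u + x ^+ i.+1 *: m') ->
  forall m, xlayer i m -> U m.
Proof.
move=> [U0 UM] cov m im; have [d] := ubnP (n - i).
have step l : (i <= l)%N -> forall m, xlayer l m ->
    exists u m' : M, U u /\ m = u + x ^+ l.+1 *: m'.
  move=> le_il _ [m0 ->]; have [|u [m1 [Uu E]]] := cov (x ^+ i *: m0); first by exists m0.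
  exists (x ^+ (l - i) *: u), m1; split; first by rewrite -[_ *: u]addr0; exact: UM.
  by rewrite -[in LHS](subnK le_il) exprD -scalerA E scalerDr scalerA -exprD addnS subnK.
suff all l d' m' : (n - l < d')%N -> (i <= l)%N -> xlayer l m' -> U m'.
  by move=> lt_d; exact: all lt_d (leqnn i) im.
elim: d' l m' => // d' IH l m'; rewrite ltnS => le_d le_il lm'.
case: (leqP n l) => [le_nl|lt_ln]; first by rewrite (xlayer_n (xlayer_le le_nl lm')).
have [u [m1 [Uu ->]]] := step l le_il m' lm'.
rewrite addrC -[x ^+ _ *: _]scale1r; apply: UM => //; apply: (IH l.+1).
- by apply: leq_trans le_d; rewrite ltn_sub2l.
- exact: ltnW.
- by exists m1.
Qed.

(** If U lies in x^i He but not in x^(i+1) He, then it is x^i He. *)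
Lemma submodule_xlayer U : submodule U ->
  exists2 i, (i <= n)%N & forall m, U m <-> xlayer i m.
Proof.
move=> sU; apply: NNPP => nU.
suff sub i : (i <= n)%N -> forall m, U m -> xlayer i m.
  apply: nU; exists n => // m; split; first exact: sub.
  by move/xlayer_n ->; case: sU.
elim: i => [|i IH] lt_in m Um; first by exists m; rewrite expr0 scale1r.
have [|cov] := layer_dichotomy sU (IH (ltnW lt_in)); first exact.
case: nU; exists i; first exact: ltnW.
by move=> m'; split; [exact: IH (ltnW lt_in) m' | exact: layer_sub].
Qed.

Lemma lideal_uniserial : uniserial_mod M.
Proof.
move=> U W /submodule_xlayer[i _ Ui] /submodule_xlayer[l _ Wl].
case: (leqP i l) => [le_il|/ltnW le_li]; [right|left] => m.
  by move/Wl/(xlayer_le le_il)/Ui.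
by move/Ui/(xlayer_le le_li)/Wl.
Qed.

Lemma gen1_neq0 : gen 1 <> 0.
Proof.
move/(congr1 (@lideal_val _ _ _)); rewrite lideal_genE rmorph1 mul1r lideal_val0.
by rewrite -(rmorph0 j) => /(can_inj xcoef0_j); case: pe.
Qed.

Lemma lideal_indecomposable : indecomposable_mod M.
Proof.
split; first by exists (gen 1); exact: gen1_neq0.
move=> U W sU sW _ UW0; have [UW|WU] := lideal_uniserial sU sW.
  by left=> m Um; apply: UW0 => //; exact: UW.
by right=> m Wm; apply: UW0 => //; exact: WU.
Qed.

Lemma xlayer1_coef0 m : xlayer 1 m -> xc 0 (lideal_val m) = 0.
Proof. by case=> m' ->; rewrite lideal_valZ xcoef_xpow // expr1. Qed.

End Projective.
End SubmodulesOfProjectives.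

(** * Composition factors and the classification of projectives *)

Section CompositionSeries.
Variables (k : fieldType) (p : nat) (G : finGroupType) (A : falgType k).
Notation kG := (grpalg k G).
Variables (j : {lrmorphism kG -> A}) (x : A) (n : nat) (chi c : G -> k) (a : G).
Notation jg g := (j (gelt k g)).
Notation xc := (xcoef j x n).
Hypothesis (hp : p \in [pchar k]).
Hypothesis hP : nil_presentation p j x n chi c a.
Hypothesis G_unit : #|G|%:R != 0 :> k.
Implicit Types (u v e f : kG) (h : A) (lam mu : G -> k).

Let bx := np_basis hP.
Let n0 : (0 < n)%N := ltnW (np_n hP).
Let chiL := np_chi hP.

Lemma simple_exists lam e : idem_assoc lam e ->
  exists L : lmodType A, simple_mod L /\ has_character (restr j L) lam.
Proof.
move=> [pe he]; have [|L [xL isoL]] := inflation hP (V := lideal e).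
  by move=> g v; rewrite (conj_defect0 hp hP G_unit) scale0r.
exists L; split; last exact: iso_has_character isoL he.
apply/(simple_restr hp hP); split=> //; apply: iso_simple_mod (iso_mod_sym isoL) _.
exact: primitive_lideal_simple.
Qed.

(** L is generated over kG by some l = e_i l with e_i = shift chi i e, as it
    has the character of kG e_i; the map sends m to (the i-th coefficient of m)
    applied to l. *)
Lemma layer_quotient lam e i (L : lmodType A) : (i < n)%N -> idem_assoc lam e ->
    simple_mod L -> has_character (restr j L) (twist lam chi i) ->
  quotient_iso (xlayer (j := j) (e := e) x i) (xlayer (j := j) (e := e) x i.+1) L.
Proof.
move=> lt_in he sL hL; have [pe _] := he; have [e0 ee _] := pe.
have jee : j e * j e = j e by rewrite -rmorphM ee.
have hse := shift_idem_assoc chiL i he.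
have [l0 l0N0] := idem_assoc_act G_unit hL hse.
pose l : L := shift chi i e *: (l0 : restr j L).
have lN0 : l <> 0 by apply/eqP.
have sel : j (shift chi i e) *: l = l.
  by rewrite /l !restr_scaleE scalerA -rmorphM -shiftM // ee.
have [sLr xL] := (simple_restr hp hP L).1 sL.
pose f (m : lideal (j e)) : L := j (xc i (lideal_val m)) *: l.
have xc_layer (m : lideal (j e)) h :
    xlayer x i m -> xc i (h * lideal_val m) = xc 0 h * xc i (lideal_val m).
  case=> m' ->; rewrite lideal_valZ; have [h' hE] := x_decomp hp hP G_unit h.
  rewrite {1}hE mulrDl linearD /= xcoef_jl //.
  have [h2 hE2] := xpow_normal hp hP G_unit i (x * h').
  have [h3 hE3] := xpow_normal hp hP G_unit i h'.
  rewrite -[x * h' * _]mulrA [h' * _]mulrA hE3 !mulrA -exprS -!mulrA.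
  by rewrite [X in _ + X](xcoef_xpow hp hP G_unit) // ltnn addr0.
have f_lin h (m1 m2 : lideal (j e)) : xlayer x i m1 -> f (h *: m1 + m2) = h *: f m1 + f m2.
  move=> m1i; rewrite /f lideal_valD lideal_valZ linearD /= xc_layer // rmorphD scalerDl.
  congr (_ + _); rewrite rmorphM -scalerA [RHS](act_killed hP) //.
exists f; split.
- by move=> h m1 m2 m1i _; exact: f_lin.
- have [|h|h] := sLr.2 (fun y : L => exists2 m, xlayer x i m & f m = y).
  + split.
      exists 0; first by exists 0; rewrite scaler0.
      by rewrite /f lideal_val0 linear0 rmorph0 scale0r.
    move=> b y1 y2 [m1 m1i <-] [m2 m2i <-]; exists (j b *: m1 + m2).
      exact: (xlayer_submodule hp hP G_unit e i).2.
    exact: f_lin.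
  + case: lN0; apply: h; exists (x ^+ i *: lideal_gen (j e) 1).
      by exists (lideal_gen (j e) 1).
    rewrite /f lideal_valZ lideal_genE mul1r (xcoef_xpow hp hP G_unit) // leqnn subnn.
    by rewrite (xcoef0_j hP).
  + by move=> y; have [m mi my] := h y; exists m.
move=> m [m0 ->]; split; last first.
  case=> m1 ->; rewrite /f lideal_valZ (xcoef_xpow hp hP G_unit) // ltnn.
  by rewrite rmorph0 scale0r.
have [v [m1 [ve ->]]] := gen_decomp hp hP G_unit pe m0.
have fE : f (x ^+ i *: (lideal_gen (j e) (j v) + x *: m1)) = j (shift chi i v) *: l.
  rewrite /f lideal_valZ lideal_valD lideal_valZ (xcoef_xpow hp hP G_unit) // leqnn subnn.
  rewrite linearD /= -[x in X in _ + X]expr1 (xcoef_xpow hp hP G_unit) // addr0.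
  by rewrite lideal_genE -rmorphM (xcoef0_j hP) ve.
rewrite fE => vl0.
have [|| h0 | [_ el]] := @primitive_left_ideal _ _ G_unit e
  (fun v => v * e = v /\ j (shift chi i v) *: l = 0) pe.
- split; first by rewrite mul0r /shift gtwist0 rmorph0 scale0r.
  move=> b v1 v2 [v1e v1l] [v2e v2l]; split; first by rewrite mulrDl -mulrA v1e v2e.
  rewrite {1}/shift gtwistD -!/(shift _ _ _) shiftM // rmorphD rmorphM scalerDl -scalerA.
  by rewrite v1l v2l scaler0 addr0.
- by move=> v' [].
- have -> : v = 0 by exact: h0.
  exists m1; rewrite scalerDr scalerA exprSr -[X in X + _ = _](_ : 0 = _) ?add0r //.
  have -> : lideal_gen (j e) (j 0) = 0.
    by apply: lideal_val_inj; rewrite lideal_genE rmorph0 mul0r.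
  by rewrite scaler0.
by case: lN0; rewrite -sel.
Qed.

Lemma lideal_series lam e : idem_assoc lam e ->
  descending_series (lideal (j e)) n (fun i L =>
    simple_mod L /\ has_character (restr j L) (twist lam chi i)).
Proof.
move=> he; exists (fun i => xlayer (j := j) (e := e) x i); split.
- by move=> i; exact: (xlayer_submodule hp hP G_unit).
- by move=> m; exists m; rewrite expr0 scale1r.
- by move=> m; exact: (xlayer_n hP).
move=> i lt_in; split; first by move=> m; exact: xlayerS.
  exact: simple_exists (shift_idem_assoc chiL i he).
by move=> L [sL hL]; exact: (layer_quotient lt_in he sL hL).
Qed.

(** By nilpotency of x some p0 lies outside xP, so a coordinate functional on
    P takes a value at p0 outside xH.  Followed by right multiplication by a
    suitable primitive idempotent f it maps P into Hf with image outside xHf,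
    hence onto Hf.  The map splits, and P is indecomposable. *)
Lemma projective_classification (P : lmodType A) :
  indecomposable_mod P -> projective_mod P ->
  exists2 f, primitive_idem f & iso_mod P (lideal (j f)).
Proof.
move=> [[q q0] indP] prP.
have [p0 p0x] : exists p0 : P, forall q, p0 <> x *: q.
  apply: NNPP => h; apply: q0.
  have all i : forall q : P, exists q', q = x ^+ i *: q'.
    elim: i => [|i IH] q'; first by exists q'; rewrite expr0 scale1r.
    have [q1 ->] := IH q'; have [q2 ->] : exists q2, q1 = x *: q2.
      by apply: NNPP => h1; apply: h; exists q1 => q2 q12; apply: h1; exists q2.
    by exists q2; rewrite scalerA exprSr.
  by have [q' ->] := all n q; rewrite (np_nil hP) scale0r.
have [phi phix] := projective_coordinate prP p0x.
pose u := xc 0 (phi p0).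
have u0 : u <> 0.
  have [h hE] := x_decomp hp hP G_unit (phi p0); rewrite -/u in hE.
  by move=> u0; apply: (phix h); rewrite [LHS]hE u0 rmorph0 add0r.
have [f pf uf] : exists2 f, primitive_idem f & u * f <> 0.
  apply: NNPP => h; apply: u0; rewrite -[u]mulr1.
  apply: (idempotent_ind (P := fun f => u * f = 0)); first exact: mulr0.
  - by move=> f pf; apply: NNPP => uf; apply: h; exists f.
  - by move=> f g uf ug; rewrite mulrDr uf ug addr0.
  - exact: mulr1.
have [_ ff _] := pf.
have jff : j f * j f = j f by rewrite -rmorphM ff.
pose theta (q : P) : lideal (j f) := lideal_gen (j f) (phi q).
have thetaL : linear theta.
  move=> h q1 q2; apply: lideal_val_inj; rewrite lideal_valD lideal_valZ !lideal_genE.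
  by rewrite linearP mulrDl -mulrA.
pose theta' : {linear P -> lideal (j f)} :=
  HB.pack theta (GRing.isLinear.Build _ _ _ _ theta thetaL).
have theta_surj y : exists q, theta' q = y.
  have [|i _ imE] := submodule_xlayer hp hP G_unit pf (U := fun y => exists q, theta' q = y).
    split; first by exists 0; rewrite linear0.
    by move=> h _ _ [q1 <-] [q2 <-]; exists (h *: q1 + q2); rewrite linearP.
  apply/imE; case: i imE => [|i] imE; first by exists y; rewrite expr0 scale1r.
  have /imE p0i : exists q, theta' q = theta p0 by exists p0.
  have := xlayer1_coef0 hp hP G_unit (xlayer_le (ltn0Sn i) p0i); rewrite lideal_genE.
  have [h hE] := x_decomp hp hP G_unit (phi p0); rewrite hE mulrDl linearD /=.
  rewrite -rmorphM (xcoef0_j hP).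
  rewrite -mulrA -[x in X in _ + X]expr1 (xcoef_xpow hp hP G_unit) // addr0.
  by move/uf.
pose idL : {linear lideal (j f) -> lideal (j f)} := idfun.
have [s sK] := (lideal_projective jff) P _ theta' idL theta_surj.
exists f => //; exists theta'.
have [|||| s0 | ker0] := indP (fun q => exists y, q = s y) (fun q => theta' q = 0).
- split; first by exists 0; rewrite linear0.
  by move=> h _ _ [y1 ->] [y2 ->]; exists (h *: y1 + y2); rewrite linearP.
- split; first exact: linear0.
  by move=> h q1 q2 E1 E2; rewrite linearP E1 E2 scaler0 addr0.
- move=> q1; exists (s (theta' q1)), (q1 - s (theta' q1)); split; first by exists (theta' q1).
    by rewrite linearB [theta' (s _)]sK subrr.
  by rewrite addrC subrK.
- by move=> _ [y ->]; rewrite sK /= => ->; rewrite linear0.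
- case: (gen1_neq0 hP pf); set y := lideal_gen _ _.
  have sy : s y = 0 by apply: s0; exists y.
  by have := sK y; rewrite sy linear0.
exists s => // q1; apply/eqP; rewrite -subr_eq0; apply/eqP/ker0.
by rewrite linearB sK subrr.
Qed.
End CompositionSeries.

(** * Blocks *)

Section CentralIdempotents.
Variables (k : fieldType) (A : falgType k) (e : A).
Hypotheses (ee : e * e = e) (ind_e : indecomposable_mod (lideal e)).

Lemma central_act_id (z : A) : central_elt z -> z * e = e -> forall m : lideal e, z *: m = m.
Proof.
move=> zc ze m; apply: lideal_val_inj; rewrite lideal_valZ.
by rewrite -(lideal_valK ee m) mulrA zc -mulrA ze.
Qed.

Lemma act_id_mul (z : A) : (forall m : lideal e, z *: m = m) -> z * e = e.
Proof.
move=> /(_ (lideal_gen e 1))/(congr1 (@lideal_val _ _ e)).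
by rewrite lideal_valZ lideal_genE mul1r.
Qed.

Lemma central_idem_indecomposable (z : A) : central_elt z -> z * z = z ->
  z * e = e \/ z * e = 0.
Proof.
move=> zc zz; have [|||| z1 | z0] := ind_e.2 (fun m => z *: m = m) (fun m => z *: m = 0).
- split=> [|h u v Eu Ev]; first by rewrite scaler0.
  by rewrite scalerDr scalerA zc -scalerA Eu Ev.
- split=> [|h u v Eu Ev]; first by rewrite scaler0.
  by rewrite scalerDr scalerA zc -scalerA Eu Ev scaler0 addr0.
- move=> m; exists (z *: m), (m - z *: m); split.
  + by rewrite scalerA zz.
  + by rewrite scalerBr scalerA zz subrr.
  + by rewrite addrC subrK.
- by move=> m -> .
- right; have := z1 (z *: lideal_gen e 1); rewrite scalerA zz => /(_ erefl).
  by move/(congr1 (@lideal_val _ _ e)); rewrite lideal_valZ lideal_genE mul1r.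
left; have := z0 (lideal_gen e 1 - z *: lideal_gen e 1).
rewrite scalerBr scalerA zz subrr => /(_ erefl)/(congr1 (@lideal_val _ _ e)).
rewrite -scaleN1r lideal_valD !lideal_valZ lideal_genE !mul1r mulN1r.
by move/eqP; rewrite subr_eq0 => /eqP.
Qed.

(** A central idempotent fixing e whose ideal has least dimension is
    primitive, since one of its summands would again fix e. *)
Lemma block_exists : exists2 z : A, central_primitive_idem z & z * e = e.
Proof.
have e0 : e <> 0.
  move=> e0; have [[m m0] _] := ind_e; apply: m0; apply: lideal_val_inj.
  rewrite -(lideal_valK ee).
  exact: etrans (congr1 (fun t => lideal_val m * t) e0) (mulr0 _).
have : exists z : A, [/\ central_elt z, z * z = z & z * e = e].
  by exists 1; split; rewrite ?mul1r // => u; rewrite mul1r mulr1.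
case=> z; have [d] := ubnP (\dim (limg (amulr z))); elim: d z => // d IH z.
rewrite ltnS => le_d [zc zz ze].
case: (classic (central_primitive_idem z)) => [pz|npz]; first by exists z.
have [z1 [z2 [c1 c2 [i1 i2] o12 [zE [n1 n2]]]]] : exists z1 z2,
    [/\ central_elt z1, central_elt z2, z1 * z1 = z1 /\ z2 * z2 = z2, z1 * z2 = 0
      & z = z1 + z2 /\ (z1 <> 0 /\ z2 <> 0)].
  apply: NNPP => h; apply: npz; split=> // [z0|f g cf cg ff gg fg zE].
    by apply: e0; rewrite -ze z0 mul0r.
  by apply: NNPP => /not_or_and[nf ng]; apply: h; exists f, g; split.
have o21 : z2 * z1 = 0 by rewrite c2.
have z1e : z1 * e = e -> exists2 z0 : A, central_primitive_idem z0 & z0 * e = e.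
  move=> E; apply: (IH z1) => //; apply: leq_trans le_d; rewrite zE.
  exact: dim_orthogonal_summand.
have [/z1e //|z1e0] := central_idem_indecomposable c1 i1.
apply: (IH z2).
  by apply: leq_trans le_d; rewrite zE addrC; exact: dim_orthogonal_summand.
by split=> //; rewrite -{2}ze zE mulrDl z1e0 add0r.
Qed.
End CentralIdempotents.

Section IdealIdentity.
Variables (k : fieldType) (G : finGroupType).
Notation kG := (grpalg k G).
Hypothesis G_unit : #|G|%:R != 0 :> k.

(** Averaging a right identity over conjugation makes it central. *)
Lemma ideal_central_identity (U : kG -> Prop) : left_ideal U ->
    (forall u v, U u -> U (u * v)) ->
  exists2 w, U w & (forall u, w * u = u * w) /\ forall v, U v -> v * w = v.
Proof.
move=> lU Ur; have [U0 UM] := lU; have [u Uu uP] := left_ideal_right_identity G_unit lU.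
have Ul b v : U v -> U (b * v) by move=> Uv; rewrite -[_ * _]addr0; exact: UM.
have UD v w : U v -> U w -> U (v + w) by move=> Uv Uw; rewrite -[v]mul1r; exact: UM.
exists ((#|G|%:R^-1 : k) *: conj_sum u).
  rewrite -[conj_sum u]mul1r scalerAl; apply: (Ul).
  rewrite /conj_sum; elim/big_ind: _ => // g _.
  exact/Ur/Ul.
split=> [v|v Uv]; first by rewrite -scalerAl -scalerAr conj_sumC.
rewrite -scalerAr /conj_sum mulr_sumr (eq_bigr (fun=> v)) => [|g _].
  by rewrite sumr_const -scaler_nat scalerA mulVf // scale1r.
have vg : v * gelt k g^-1%g * u = v * gelt k g^-1%g by exact/uP/Ur.
by rewrite !mulrA vg -mulrA -geltM mulVg gelt1 mulr1.
Qed.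
End IdealIdentity.

Section Blocks.
Variables (k : fieldType) (p : nat) (G : finGroupType) (A : falgType k).
Notation kG := (grpalg k G).
Variables (j : {lrmorphism kG -> A}) (x : A) (n : nat) (chi c : G -> k) (a : G).
Hypothesis (hp : p \in [pchar k]).
Hypothesis hP : nil_presentation p j x n chi c a.
Hypothesis G_unit : #|G|%:R != 0 :> k.
Implicit Types (u v e f : kG) (h : A) (lam mu : G -> k).

Let chiL := np_chi hP.

Lemma lin_char_card g : chi g ^+ #|G| = 1.
Proof.
have chiX i : chi g ^+ i = chi (g ^+ i)%g.
  elim: i => [|i IH]; first by rewrite expr0 expg0 chiL.1.
  by rewrite exprS IH expgS chiL.2.
by rewrite chiX -cardsT expg_cardG ?inE // chiL.1.
Qed.

Lemma shift_period i e : shift chi (i + #|G|) e = shift chi i e.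
Proof. by apply/ffunP=> g; rewrite !ffunE exprD lin_char_card mulr1. Qed.

(** The idempotent z fixes or kills shift(e).  It cannot kill it, since
    x e = z x e = z shift(e) x and x e is nonzero. *)
Lemma block_shift e z i : primitive_idem e -> central_elt z -> z * z = z ->
  z * j e = j e -> z * j (shift chi i e) = j (shift chi i e).
Proof.
move=> pe zc zz ze; elim: i => [|i IH]; first by rewrite shift0.
rewrite shiftS; set f := shift chi i e in IH *.
have pf : primitive_idem f by exact: shift_primitive.
have ps : primitive_idem (shift chi 1 f) by exact: shift_primitive.
have jss : j (shift chi 1 f) * j (shift chi 1 f) = j (shift chi 1 f).
  by rewrite -rmorphM; case: ps => _ ->.
have [//|zs] := central_idem_indecomposable (lideal_indecomposable hp hP G_unit ps) zc zz.
have xf : x * j f = 0.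
  by rewrite -IH mulrA -zc -mulrA (x_j hp hP G_unit) mulrA zs mul0r.
have [s0 _ _] := ps; case: s0.
have := congr1 (xcoef j x n 1) xf; rewrite linear0 -[x in x * _]expr1.
by rewrite (xcoef_xpow hp hP G_unit) ?(np_n hP) //= subnn (xcoef0_j hP).
Qed.

(** A block idempotent for e fixes e_i = shift chi i e; as f has the same
    character as e_i it factors through e_i. *)
Lemma same_block_twist lam mu e f i : idem_assoc lam e -> idem_assoc mu f ->
  mu =1 twist lam chi i -> same_block (lideal (j e)) (lideal (j f)).
Proof.
move=> he hf muE; have [pe _] := he; have [pf _] := hf.
have [_ ee _] := pe; have [_ ff _] := pf.
have jee : j e * j e = j e by rewrite -rmorphM ee.
have jff : j f * j f = j f by rewrite -rmorphM ff.
have [z pz ze] := block_exists jee (lideal_indecomposable hp hP G_unit pe).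
have [zc _ zz _] := pz.
have [ps hs] := shift_idem_assoc chiL i he.
have hs' : idem_assoc mu (shift chi i e).
  by split=> //; apply: eq_has_character hs => g; rewrite muE.
have [w fwe] := idem_assoc_link G_unit hs' hf.
have [b [b' [b'b bb' bs _]]] := primitive_factor G_unit ps pf fwe.
exists z => //; split; apply: central_act_id => //.
rewrite -bb' rmorphM -bs rmorphM mulrA mulrA zc -(mulrA (j b)) block_shift //.
Qed.

(** Suppose that f is not linked to any shift chi i e.  Then f lies in the
    ideal B of elements annihilating all of them, whose identity w is a
    shift-invariant central idempotent with w e = 0 and w f = f.  So j w is
    central in H and cuts the block idempotent z in two, z = z w + (z - z w),
    with both parts nonzero. *)
Lemma same_block_only_twist lam mu e f : idem_assoc lam e -> idem_assoc mu f ->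
  same_block (lideal (j e)) (lideal (j f)) -> exists i, mu =1 twist lam chi i.
Proof.
move=> he hf [z pz [/act_id_mul ze /act_id_mul zf]].
have [zc z0 zz zP] := pz; have [[e0 ee _] _] := he; have [[f0 ff _] _] := hf.
apply: NNPP => ntw.
pose B v := forall i u, v * u * shift chi i e = 0.
have Bf : B f.
  move=> i u; apply/eqP/negPn/negP=> fue; apply: ntw; exists i.
  exact: link_eq_character (shift_idem_assoc chiL i he) hf fue.
have [||w Bw [wc wP]] := @ideal_central_identity _ _ G_unit B.
- split=> [i u|b u v Bu Bv i s]; first by rewrite !mul0r.
  by rewrite !mulrDl Bv addr0 -!mulrA (mulrA u) Bu mulr0.
- by move=> u v Bu i s; rewrite -(mulrA u) Bu.
(* B is stable under shift, whose order is finite, and under its inverse; the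
   two central right identities w and shift w of B therefore agree. *)
have ww : shift chi 1 w = w.
  have Bw' : B (shift chi 1 w).
    move=> i u; rewrite -[shift chi i e]shift_period.
    have -> : (i + #|G| = (i + #|G|).-1.+1)%N.
      by rewrite prednK // addn_gt0; apply/orP; right; apply/card_gt0P; exists 1%g.
    rewrite (shiftS chi (i + #|G|).-1) -[u](unshiftK chiL 1) -!shiftM // Bw.
    by rewrite /shift gtwist0.
  have Bw2 : B (unshift chi 1 w).
    move=> i u; rewrite -[u](shiftK chiL 1) -[shift chi i e](shiftK chiL 1) -!unshiftM //.
    by rewrite -shiftS Bw /unshift gtwist0.
  have E := congr1 (shift chi 1) (wP _ Bw2); rewrite shiftM // !unshiftK // in E.
  by rewrite -(wP _ Bw') -wc E.
have jwc : central_elt (j w).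
  have xw i : x ^+ i * j w = j w * x ^+ i.
    elim: i => [|i IH]; first by rewrite expr0 mul1r mulr1.
    by rewrite exprS -mulrA IH mulrA (x_j hp hP G_unit) ww mulrA.
  move=> h; rewrite (xcoefE (np_basis hP) h) mulr_sumr mulr_suml; apply: eq_bigr => i _.
  by rewrite mulrA -rmorphM wc rmorphM -mulrA -xw mulrA.
have jww : j w * j w = j w by rewrite -rmorphM wP.
have jwe : j w * j e = 0.
  by have := Bw 0%N 1; rewrite mulr1 shift0 -rmorphM => ->; rewrite rmorph0.
pose t := z * j w.
have tc : central_elt t by move=> u; rewrite /t -mulrA jwc [LHS]mulrA (zc u) [RHS]mulrA.
have zt : z * t = t by rewrite /t mulrA zz.
have tz : t * z = t by rewrite -zc.
have tt : t * t = t by rewrite {1}/t -mulrA jwc -mulrA jww.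
have [|||||t0|zt0] := zP t (z - t) tc.
- by move=> u; rewrite mulrBl mulrBr zc tc.
- exact: tt.
- by rewrite mulrBl !mulrBr zz zt tz tt subrr subr0.
- by rewrite mulrBr tz tt subrr.
- by rewrite addrC subrK.
- have fw : w * f = 0.
    by apply: (can_inj (xcoef0_j hP)); rewrite rmorphM /= -zf mulrA jwc -/t t0 mul0r rmorph0.
  by apply: f0; rewrite -(wP _ Bf) -wc fw.
apply: e0; apply: (can_inj (xcoef0_j hP)); rewrite rmorph0 -ze.
by move/eqP: zt0; rewrite subr_eq0 => /eqP ->; rewrite -mulrA jwe mulr0.
Qed.
End Blocks.

Theorem theorem3p19 (k : fieldType) (p : nat) (hp : p \in [pchar k])
    (G : finGroupType) (H : hopfAlg k) (H0 : {vspace H})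
    (j : {lrmorphism grpalg k G -> H}) (x : H) (chi : G -> k) (n : nat)
    (hH0 : is_coradical H0) (hpointed : pointed H) (hrank : rank_one H0)
    (hnil : nilpotent_type H0)
    (hH : (exists2 R : datumR k p G, chi = R_chi R & is_HR j x R) \/
          (exists2 F : datumF k p G, chi = F_chi F & is_HF j x F))
    (hn : is_degree H0 x n) :
  (* (a) *)
  ((forall M : lmodType H,
      simple_mod M <-> (simple_mod (restr j M) /\ forall m : M, x *: m = 0)) /\
   (forall V : lmodType (grpalg k G), simple_mod V ->
      exists M : lmodType H,
        (forall m : M, x *: m = 0) /\ iso_mod (restr j M) V)) /\
  (* (b) *)
  (semisimple_subalg H0 ->
    (forall (lam : G -> k) (L : lmodType H) (e : grpalg k G),
       simple_with_char j lam L -> idem_assoc lam e ->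
       indecomposable_mod (lideal (j e)) /\ projective_mod (lideal (j e))) /\
    (forall P : lmodType H, indecomposable_mod P -> projective_mod P ->
       exists (lam : G -> k) (L : lmodType H) (e : grpalg k G),
         [/\ simple_with_char j lam L, idem_assoc lam e
           & iso_mod P (lideal (j e))])) /\
  (* (c) *)
  (semisimple_subalg H0 ->
    (forall (lam : G -> k) (L : lmodType H) (e : grpalg k G),
       simple_with_char j lam L -> idem_assoc lam e ->
       uniserial_mod (lideal (j e)) /\
       descending_series (lideal (j e)) n
         (fun i => simple_with_char j (twist lam chi i))) /\
    (forall (lam mu : G -> k) (L L' : lmodType H) (e f : grpalg k G),
       simple_with_char j lam L -> idem_assoc lam e ->
       simple_with_char j mu L' -> idem_assoc mu f ->
       (same_block (lideal (j e)) (lideal (j f)) <->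
        exists i : nat, mu =1 twist lam chi i))).
Proof.
have [H0E [c [a hP]]] : H0 = limg (linfun j) /\
    exists c a, nil_presentation p j x n chi c a.
  case: hH => [[R -> isR]|[F -> isF]].
    have [H0E hP] := HR_nil hp hH0 hpointed hrank hnil isR; split=> //.
    exists (fun=> 0), (R_a R).
    by rewrite (is_degree_basis (ltnW (np_n hP)) (np_basis hP) (np_nil hP) H0E hn).
  have [H0E hP] := HF_nil hp hH0 hpointed hrank hnil isF; split=> //.
  exists (F_c F), (F_a F).
  by rewrite (is_degree_basis (ltnW (np_n hP)) (np_basis hP) (np_nil hP) H0E hn).
have unitG : semisimple_subalg H0 -> #|G|%:R != 0 :> k.
  by rewrite H0E; apply/semisimple_card_unit/can_inj/(xcoef0_j hP).
split; last split.
- split=> [M|V sV]; first exact: (simple_restr hp hP).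
  exact: (inflation hP (simple_grpalg_killed_by_defect hp hP sV)).
- move=> /unitG G_unit; split=> [lam L e _ [pe _]|P indP prP].
    split; first exact: (lideal_indecomposable hp hP G_unit pe).
    by apply: lideal_projective; have [_ ee _] := pe; rewrite -rmorphM ee.
  have [e pe isoP] := projective_classification hp hP G_unit indP prP.
  have [_ ee _] := pe.
  have he : idem_assoc (fun g => trace_form (gelt k g) e) e by apply/idem_assocE.
  have [L hL] := simple_exists hp hP G_unit he.
  by exists (fun g => trace_form (gelt k g) e), L, e.
move=> /unitG G_unit; split=> [lam L e _ he|lam mu L L' e f _ he _ hf].
  split; first exact: (lideal_uniserial hp hP G_unit he.1).
  exact: (lideal_series hp hP G_unit he).
split; first exact: (same_block_only_twist hp hP G_unit he hf).
by case=> i; exact: (same_block_twist hp hP G_unit he hf).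
Qed.
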